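(* Let $({\mathscr W},\mathcal W)$ and $(\mathscr Y,\mathcal Y)$ be measurable spaces and let $X_1=(W_1,Y_1),\ldots,X_n=(W_n,Y_n)$ be independent random variables with values in ${\mathscr W}\times\mathscr Y$. For each $i$, let $P_{W_i}$ be the (arbitrary, unknown) distribution of $W_i$, and assume the conditional distribution of $Y_i$ given $W_i=w$ exists and equals $Q_i^\star(w)$, where $Q_i^\star$ is a measurable map from ${\mathscr W}$ to the set of probabilities on $\mathscr Y$ (no other assumption is made on $Q_i^\star$ or $P_{W_i}$). Let $\{Q_\theta,\ \theta\in I\}$ be an exponential family as described in the context, let $\overline{\Theta}$ be a class of functions from ${\mathscr W}$ to $I$ which is VC-subgraph with dimension not larger than $V\ge 1$, let $\Theta\subset\overline\Theta$ be finite or countable, and let $\widehat\theta$ be the $\rho$-estimator built on $\Theta$ as in the context. Then for every $\xi>0$, with probability at least $1-e^{-\xi}$, $$\mathbf h^2\big(\mathbf Q^\star,\mathbf Q_{\widehat\theta}\big)\le 150\,\inf_{\theta\in\Theta}\mathbf h^2(\mathbf Q^\star,\mathbf Q_\theta)+1.1\times10^{6}\,V\Big[9.11+\log_+\Big(\frac nV\Big)\Big]+5014\,(1.5+\xi),$$ where $\log_+=\max(0,\log)$.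
   Context: Exponential family: $\nu$ is a $\sigma$-finite measure on $(\mathscr Y,\mathcal Y)$, $S:\mathscr Y\to\mathbb R$ is measurable and not $\nu$-a.e. constant, $I\subset\mathbb R$ is an interval with nonempty interior on which $A(\theta)=\log\int_{\mathscr Y}e^{\theta S(y)}d\nu(y)$ is finite, and $Q_\theta$ has density $q_\theta(y)=e^{S(y)\theta-A(\theta)}$ with respect to $\nu$. For a function $\theta:{\mathscr W}\to I$ write $q_\theta(x)=q_{\theta(w)}(y)$ for $x=(w,y)$. Hellinger distance: $h^2(P,R)=\frac12\int(\sqrt p-\sqrt r)^2d\mu$ for $P=p\cdot\mu$, $R=r\cdot\mu$. Loss: $\mathbf h^2(\mathbf Q^\star,\mathbf Q_\theta)=\sum_{i=1}^n\int_{{\mathscr W}}h^2\big(Q_i^\star(w),Q_{\theta(w)}\big)\,dP_{W_i}(w)$. VC-subgraph with dimension not larger than $V$: the class of subgraphs $\{(w,t)\in{\mathscr W}\times\mathbb R:\ f(w)>t\}$, $f$ in the class, shatters no finite subset of ${\mathscr W}\times\mathbb R$ of cardinality larger than $V$. $\rho$-estimator: let $\psi(x)=(x-1)/(x+1)$ for $x\in[0,\infty)$ and $\psi(+\infty)=1$; for $\theta,\theta'\in\Theta$ let $\mathbf T(\mathbf X,\theta,\theta')=\sum_{i=1}^n\psi\big(\sqrt{q_{\theta'}(X_i)/q_\theta(X_i)}\big)$ with conventions $0/0=1$, $a/0=+\infty$ for $a>0$; let $\upsilon(\mathbf X,\theta)=\sup_{\theta'\in\Theta}\mathbf T(\mathbf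 X,\theta,\theta')$; $\widehat\theta$ is any measurable element of $\{\theta\in\Theta:\ \upsilon(\mathbf X,\theta)\le\inf_{\theta'\in\Theta}\upsilon(\mathbf X,\theta')+\kappa/25\}$ with $\kappa=280\sqrt2+74$. *)

(* Defs.v *)
From HB Require Import structures.
From mathcomp Require Import all_boot all_order all_algebra.
From mathcomp Require Import all_classical all_reals all_analysis measurable_realfun.
From Stdlib Require Import ClassicalEpsilon.

Set Implicit Arguments.
Unset Strict Implicit.
Unset Printing Implicit Defensive.

Import Order.TTheory GRing.Theory Num.Theory.
Local Open Scope classical_set_scope.
Local Open Scope ring_scope.

Section Defs.
Context {R : realType}.

(** Mutual independence of a finite family of random variables
    [X i : Omega -> T], i < n: product rule for every family of
    measurable sets (taking B i = setT gives all subfamilies). *)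
Definition mutually_independent {dO dT} {Omega : measurableType dO}
  {T : measurableType dT} (P : probability Omega R) (n : nat)
  (X : 'I_n -> Omega -> T) : Prop :=
  forall B : 'I_n -> set T, (forall i, measurable (B i)) ->
    fine (P (\bigcap_(i in [set: 'I_n]) (X i @^-1` B i))) =
    \prod_(i < n) fine (P (X i @^-1` B i)).

Definition is_density {dY} {Y : measurableType dY}
  (mu : set Y -> \bar R) (P : set Y -> \bar R) (p : Y -> R) : Prop :=
  measurable_fun [set: Y] p /\ (forall y, 0 <= p y) /\
  forall A, measurable A -> P A = (\int[mu]_(y in A) (p y)%:E)%E.

Definition density_of {dY} {Y : measurableType dY}
  (mu : set Y -> \bar R) (P : set Y -> \bar R) : Y -> R :=
  epsilon (inhabits (fun _ => 0)) (is_density mu P).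

Definition hellinger2 {dY} {Y : measurableType dY}
  (P Q : set Y -> \bar R) : \bar R :=
  let mu := fun A => (P A + Q A)%E in
  let p := density_of mu P in
  let q := density_of mu Q in
  ((2^-1)%:E * \int[mu]_y ((Num.sqrt (p y) - Num.sqrt (q y)) ^+ 2)%:E)%E.

Definition logpart {dY} {Y : measurableType dY}
  (nu : set Y -> \bar R) (S : Y -> R) (t : R) : R :=
  ln (fine (\int[nu]_y (expR (t * S y))%:E)%E).

Definition qdens {dY} {Y : measurableType dY}
  (nu : set Y -> \bar R) (S : Y -> R) (t : R) (y : Y) : R :=
  expR (S y * t - logpart nu S t).

Definition Qexp {dY} {Y : measurableType dY}
  (nu : set Y -> \bar R) (S : Y -> R) (t : R) : set Y -> \bar R :=
  fun B => (\int[nu]_(y in B) (qdens nu S t y)%:E)%E.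

Definition loss {dY dW} {Y : measurableType dY} {W : measurableType dW}
  (n : nat) (PW : 'I_n -> set W -> \bar R)
  (Qstar : 'I_n -> W -> set Y -> \bar R)
  (nu : set Y -> \bar R) (S : Y -> R) (theta : W -> R) : \bar R :=
  (\sum_(i < n) \int[PW i]_w hellinger2 (Qstar i w) (Qexp nu S (theta w)))%E.

Definition subgraph {W : Type} (f : W -> R) : set (W * R) :=
  [set x | x.2 < f x.1].

Definition shatters {U : Type} (C : set (set U)) (F : set U) : Prop :=
  forall G, G `<=` F -> exists2 A, C A & A `&` F = G.

Definition VC_subgraph_dim_le {W : Type} (Thb : set (W -> R)) (V : nat) :=
  forall F : set (W * R), finite_set F -> ([set: 'I_V.+1] #<= F)%card ->
    ~ shatters [set subgraph f | f in Thb] F.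

Definition psi (x : R) : R := (x - 1) / (x + 1).

Definition Tstat {dY} {Y : measurableType dY} {W : Type}
  (nu : set Y -> \bar R) (S : Y -> R) (n : nat) (x : 'I_n -> W * Y)
  (th th' : W -> R) : R :=
  \sum_(i < n) psi (Num.sqrt (qdens nu S (th' (x i).1) (x i).2
                              / qdens nu S (th (x i).1) (x i).2)).

Definition upsilon {dY} {Y : measurableType dY} {W : Type}
  (nu : set Y -> \bar R) (S : Y -> R) (Th : set (W -> R)) (n : nat)
  (x : 'I_n -> W * Y) (th : W -> R) : R :=
  sup [set Tstat nu S x th th' | th' in Th].

Definition kappa : R := 280 * Num.sqrt 2 + 74.

Definition is_rho_estimate {dY} {Y : measurableType dY} {W : Type}
  (nu : set Y -> \bar R) (S : Y -> R) (Th : set (W -> R)) (n : nat)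
  (x : 'I_n -> W * Y) (th : W -> R) : Prop :=
  Th th /\
  upsilon nu S Th x th <= inf [set upsilon nu S Th x th' | th' in Th] + kappa / 25.

Definition logplus (x : R) : R := Num.max 0 (ln x).

End Defs.

(* Main.v *)
(** A rho-estimator only has to be compared with one fixed near-minimiser
    [thb]: writing [f th = psi (sqrt (q_th / q_thb))], the criterion yields
    [- sum f thhat (X_i) <= sup_th sum f th (X_i) + kappa / 25].  Pointwise
    algebra on square roots of densities gives, for every law [P],
      [E_P (f th + (f th)^2 / 8) <= 15/4 h^2(P, Q_thb) - 1/8 h^2(P, Q_th)],
    so it suffices to bound, uniformly in [th], the deviation of
    [sum f th (X_i)] above [sum E (f th + (f th)^2 / 8)].  The quadratic term
    absorbs the variance: after introducing a ghost sample and random swaps,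
    each fixed vector of values has exponential moment at most 1, so the
    supremum costs only the number of value vectors.  After discretising [f]
    at scale [V / n], that number is controlled by Sauer's lemma, because
    [t |-> q_t(y)] is quasi-concave, hence its level sets are intervals and are
    described by two subgraph thresholds each.

    The map [w |-> h^2(Q_i^*(w), Q_theta(w))] need not be measurable for an
    arbitrary sigma-algebra on [Y]; the integral of such a nonnegative function is
    its lower integral, and only superadditivity and the behaviour under
    adding a constant are used. *)

Require Import Defs.
From HB Require Import structures.
From mathcomp Require Import all_boot all_order all_algebra.
From mathcomp Require Import zify ring lra.
From Stdlib Require ClassicalEpsilon.

Import Order.TTheory GRing.Theory Num.Theory.
Local Open Scope ring_scope.

(** * Sauer's lemma *)

Section Sauer.
Context {T : finType}.
Implicit Types (F : {set {set T}}) (A B : {set T}).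

Definition shattersb F B := [forall A in powerset B, exists X in F, X :&: B == A].

Lemma shattersbP F B :
  reflect (forall A, A \subset B -> exists2 X, X \in F & X :&: B = A) (shattersb F B).
Proof.
apply: (iffP forall_inP) => [h A AB|h A].
  by have /existsP[X /andP[XF /eqP XB]] := h A (eq_trans (powersetE _ _) AB); exists X.
by rewrite powersetE => /h[X XF <-]; apply/existsP; exists X; rewrite XF eqxx.
Qed.

Lemma shattersbS F1 F2 B : F1 \subset F2 -> shattersb F1 B -> shattersb F2 B.
Proof.
move=> /subsetP F12 /shattersbP h; apply/shattersbP => A /h[X /F12 XF XB].
by exists X.
Qed.

(* Pajor's form: split the family at an element [x] separating two members; a set
   shattered by both halves yields the extra shattered set [x |: B]. *)
Lemma card_le_shattered F : (#|F| <= #|[set B | shattersb F B]|)%N.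
Proof.
have [m] := ubnP #|F|; elim: m F => // m IH F; rewrite ltnS => Fm.
have [F1|] := leqP #|F| 1.
  have [->|[X XF]] := set_0Vmem F; first by rewrite cards0.
  apply: leq_trans F1 _; rewrite card_gt0; apply/set0Pn; exists set0.
  rewrite inE; apply/shattersbP => A; rewrite subset0 => /eqP ->.
  by exists X => //; rewrite setI0.
move=> /card_gt1P[X [Y [XF YF XY]]].
wlog [x xX xY] : X Y XF YF XY / exists2 x, x \in X & x \notin Y.
  move=> h; have [XsY|/subsetPn hx] := boolP (X \subset Y); last exact: (h X Y).
  have [YsX|/subsetPn hx] := boolP (Y \subset X).
    by case/negP: XY; rewrite eqEsubset XsY.
  by apply: (h Y X) => //; rewrite eq_sym.
pose F1 := [set Z in F | x \in Z]; pose F0 := [set Z in F | x \notin Z].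
have F01 : (#|F1| + #|F0| = #|F|)%N.
  rewrite -(cardsID [set Z : {set T} | x \in Z] F); congr (_ + _)%N; apply: eq_card => Z;
    by rewrite !inE// andbC.
have F1F : F1 \subset F by apply/subsetP => Z; rewrite inE => /andP[].
have F0F : F0 \subset F by apply/subsetP => Z; rewrite inE => /andP[].
have c1 : (0 < #|F1|)%N by rewrite card_gt0; apply/set0Pn; exists X; rewrite inE XF.
have c0 : (0 < #|F0|)%N by rewrite card_gt0; apply/set0Pn; exists Y; rewrite inE YF.
have h1 := IH F1 ltac:(lia); have h0 := IH F0 ltac:(lia).
rewrite -F01; apply: leq_trans (leq_add h1 h0) _.
set S1 := [set B | shattersb F1 B]; set S0 := [set B | shattersb F0 B].
have nx1 B : B \in S1 -> x \notin B.
  rewrite inE => /shattersbP h; apply/negP => xB.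
  have [Z ZF ZB] := h (B :\ x) (subD1set _ _).
  have : x \in Z :&: B by rewrite inE xB andbT; move: ZF; rewrite inE => /andP[].
  by rewrite ZB !inE eqxx.
have nx0 B : B \in S0 -> x \notin B.
  rewrite inE => /shattersbP h; apply/negP => xB.
  have [Z ZF ZB] := h B (subxx _).
  have : x \in Z :&: B by rewrite ZB.
  by rewrite inE xB andbT; move: ZF; rewrite inE => /andP[_ /negP].
(* Sets shattered by both halves are counted twice in the sum. The second count is paid for by the
   sets [x |: B], which lie outside the union because no set shattered by one half contains [x]. *)
rewrite -cardsUI.
rewrite -(@card_in_imset _ _ (fun B => x |: B) (S1 :&: S0)); last first.
  move=> B1 B2; rewrite !inE => /andP[b1 _] /andP[b2 _] e.
  rewrite -(@setU1K _ x B1) ?nx1 ?inE// -(@setU1K _ x B2) ?nx1 ?inE//.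
  by rewrite e.
rewrite -(cardsID (S1 :|: S0) [set B | shattersb F B]).
apply: leq_add; apply: subset_leq_card; apply/subsetP => B.
  move=> BU; rewrite inE BU andbT; move: BU; rewrite !inE.
  by move=> /orP[]; apply: shattersbS.
move=> /imsetP[B']; rewrite inE => /andP[B1 B0] ->{B}.
have xB' := nx1 _ B1.
rewrite !inE; apply/andP; split.
  apply/negP => /orP h.
  have : x \notin x |: B' by case: h => h; [apply: nx1|apply: nx0]; rewrite inE.
  by rewrite setU11.
move: B1 B0; rewrite !inE => /shattersbP B1 /shattersbP B0.
apply/shattersbP => A AB.
have AxB : A :\ x \subset B' by rewrite subDset.
have [xA|xA] := boolP (x \in A).
  have [Z ZF ZB] := B1 _ AxB; exists Z; first by apply: (subsetP F1F).
  rewrite setIUr ZB -[RHS](setD1K xA); congr (_ :|: _).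
  by apply/setIidPr; rewrite sub1set; move: ZF; rewrite inE => /andP[].
have [Z ZF ZB] := B0 _ AxB; exists Z; first by apply: (subsetP F0F).
rewrite setIUr ZB (setDidPl _) 1?disjoint_sym ?disjoints1//.
rewrite (_ : Z :&: [set x] = set0) ?set0U//.
apply/eqP; rewrite setI_eq0 disjoint_sym disjoints1.
by move: ZF; rewrite inE => /andP[].
Qed.

(** Each counted set has [a ^+ #|B| >= a ^+ V], and the sum of [a ^+ #|B|] over all subsets is
    [(1 + a) ^+ #|T|]. The parameter [a] stays free until [pattern_bound_expR] tunes it. *)
Lemma card_small_sets (R : realFieldType) (V : nat) (a : R) : 0 < a <= 1 ->
  #|[set B : {set T} | (#|B| <= V)%N]|%:R <= a^-1 ^+ V * (1 + a) ^+ #|T|.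
Proof.
move=> /andP[a0 a1]; rewrite exprVn ler_pdivlMl ?exprn_gt0// mulrC.
rewrite mulr_natl -sumr_const.
apply: (@le_trans _ _ (\sum_(B : {set T}) a ^+ #|B|)).
  rewrite [leRHS](bigID (mem [set B : {set T} | (#|B| <= V)%N])) /=.
  rewrite -[leLHS]addr0; apply: lerD; last by apply: sumr_ge0 => B _; rewrite exprn_ge0// ltW.
  by apply: ler_sum => B; rewrite inE => BV; rewrite ler_wiXn2l// ltW.
rewrite (_ : \sum_B _ = \prod_(i : T) (a + 1)).
  by rewrite prodr_const addrC.
rewrite bigA_distr; apply: eq_bigr => B _.
by rewrite -big_mkcond/= prodr_const.
Qed.

Lemma sauer (R : realFieldType) F (V : nat) (a : R) : 0 < a <= 1 ->
  (forall B, shattersb F B -> (#|B| <= V)%N) ->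
  #|F|%:R <= a^-1 ^+ V * (1 + a) ^+ #|T|.
Proof.
move=> a01 h; apply: le_trans (card_small_sets R V a a01).
rewrite ler_nat; apply: leq_trans (card_le_shattered F) _.
by apply: subset_leq_card; apply/subsetP => B; rewrite !inE; exact: h.
Qed.

End Sauer.

From mathcomp Require Import all_classical all_reals all_analysis measurable_realfun.

(** * Exponential deviation bound with a ghost sample, for finite laws *)

Lemma expR_le_inv (R : realType) (x : R) : x < 1 -> expR x <= (1 - x)^-1.
Proof.
move=> x1; rewrite -[expR x]invrK -expRN lef_pV2 ?posrE ?expR_gt0 ?subr_gt0 //.
exact: expR_ge1Dx.
Qed.

(* The exponents are [d - s] and [- d - s] with [d ^ 2 <= s]; the scale 1/50 is
   small enough for the quadratic penalty to dominate. *)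
Lemma expR_swap_le2 (R : realType) (a b : R) : `|a| <= 1 -> `|b| <= 1 ->
  expR (50^-1 * (a - b - 8^-1 * b ^+ 2)) +
  expR (50^-1 * (b - a - 8^-1 * a ^+ 2)) <= 2.
Proof.
rewrite !ler_norml => /andP[a1 a2] /andP[b1 b2].
(* The penalties in [a ^+ 2] and [b ^+ 2] are split into their mean, which is [s], and their half
   difference, which joins [a - b] in [d]. *)
pose s : R := 50^-1 * 16^-1 * (a ^+ 2 + b ^+ 2).
pose d : R := 50^-1 * (a - b) * (1 + 16^-1 * (a + b)).
have s0 : 0 <= s by rewrite mulr_ge0 // addr_ge0 ?sqr_ge0.
have ds : d ^+ 2 <= s.
  have k1 : (1 + 16^-1 * (a + b)) ^+ 2 <= 81 / 64.
    rewrite -subr_ge0.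
    rewrite [X in 0 <= X](_ : _ =
      (9 / 8 - (1 + 16^-1 * (a + b))) * (9 / 8 + (1 + 16^-1 * (a + b)))); last by field.
    by apply: mulr_ge0; lra.
  have k2 : (a - b) ^+ 2 <= 2 * (a ^+ 2 + b ^+ 2).
    rewrite -subr_ge0 [X in 0 <= X](_ : _ = (a + b) ^+ 2) ?sqr_ge0 //; ring.
  have -> : d ^+ 2 = 50^-1 ^+ 2 * ((a - b) ^+ 2 * (1 + 16^-1 * (a + b)) ^+ 2).
    by rewrite /d; ring.
  have := ler_pM (sqr_ge0 _) (sqr_ge0 _) k2 k1.
  set q := _ * (1 + _) ^+ 2; rewrite /s.
  have : 0 <= a ^+ 2 + b ^+ 2 by rewrite addr_ge0 ?sqr_ge0.
  by set t := a ^+ 2 + b ^+ 2; lra.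
have d1 : `|d| < 1.
  rewrite -(@ltr_pXn2r _ 2) ?nnegrE ?normr_ge0 // real_normK ?num_real // expr1n.
  apply: le_lt_trans ds _; rewrite /s.
  have : a ^+ 2 <= 1 by rewrite -subr_ge0 [X in 0 <= X](_ : _ = (1-a)*(1+a)); [apply: mulr_ge0; lra|ring].
  have : b ^+ 2 <= 1 by rewrite -subr_ge0 [X in 0 <= X](_ : _ = (1-b)*(1+b)); [apply: mulr_ge0; lra|ring].
  lra.
move: d1; rewrite ltr_norml => /andP[d1 d2].
rewrite (_ : _ * _ = d - s); last by rewrite /d /s; field.
rewrite (_ : _ * (b - _ - _) = - d - s); last by rewrite /d /s; field.
apply: (@le_trans _ _ ((1 - (d - s))^-1 + (1 - (- d - s))^-1)).
  by apply: lerD; apply: expR_le_inv; lra.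
have p1 : 0 < 1 - (d - s) by lra.
have p2 : 0 < 1 - (- d - s) by lra.
(* After clearing the positive denominators, the bound by 2 amounts to [d ^+ 2 <= s + s ^+ 2]. *)
rewrite -subr_ge0 [X in 0 <= X](_ : _ = 2 * (s + s ^+ 2 - d ^+ 2) /
  ((1 - (d - s)) * (1 - (- d - s)))); last by field; rewrite !gt_eqF.
rewrite divr_ge0 // ?mulr_ge0 //; try exact: ltW.
have := sqr_ge0 s; lra.
Qed.

(** The tangent line to the exponential at the mean [m] lies below it; averaging it gives
    [expR m]. *)
Lemma jensen_expR (R : realType) (E : finType) (p h : E -> R) :
  (forall e, 0 <= p e) -> \sum_e p e = 1 ->
  expR (\sum_e p e * h e) <= \sum_e p e * expR (h e).
Proof.
move=> p0 p1; set m := \sum_e p e * h e.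
have -> : expR m = \sum_e p e * (expR m * (1 + (h e - m))).
  under eq_bigr do rewrite mulrCA.
  rewrite -mulr_sumr; under eq_bigr do rewrite mulrDr mulr1 mulrBr.
  by rewrite big_split/= p1 sumrB -mulr_suml p1 mul1r subrr addr0 mulr1.
apply: ler_sum => e _; apply: ler_wpM2l => //.
rewrite -[h e in leRHS](subrKC m) expRD ler_wpM2l ?expR_ge0//.
exact: expR_ge1Dx.
Qed.

Section Ghost.
Context (R : realType) (n : nat) (J E C : finType).
Variables (p : 'I_n -> E -> R) (c : J -> E -> C) (v : C -> R) (N : nat).
Hypotheses (p0 : forall i e, 0 <= p i e) (p1 : forall i, \sum_e p i e = 1)
  (v1 : forall t, `|v t| <= 1).

Definition swap_at {T : Type} (s : {ffun 'I_n -> bool}) (z : {ffun 'I_n -> T * T}) :=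
  [ffun i => if s i then ((z i).2, (z i).1) else z i].

Definition pattern (j : J) (z : {ffun 'I_n -> E * E}) : {ffun 'I_n -> C * C} :=
  [ffun i => (c j (z i).1, c j (z i).2)].

Definition patterns z : {set {ffun 'I_n -> C * C}} := [set pattern j z | j : J].

(** [t.1] codes the sample value and [t.2] the ghost value. The penalty bears on the ghost value
    only, so that averaging over the ghost turns it into part of the centring. *)
Definition gap (t : C * C) : R :=
  expR (50^-1 * (v t.1 - v t.2 - 8^-1 * v t.2 ^+ 2)).

Definition weight (t : {ffun 'I_n -> C * C}) : R := \prod_i gap (t i).

Lemma gap_ge0 t : 0 <= gap t. Proof. exact: expR_ge0. Qed.

Lemma swap_atK {T : Type} s : involutive (@swap_at T s).
Proof. by move=> z; apply/ffunP => i; rewrite !ffunE; case: (s i) => //=; case: (z i). Qed.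

Lemma patterns_swap s z : patterns (swap_at s z) = [set swap_at s t | t in patterns z].
Proof.
rewrite /patterns -imset_comp; apply: eq_imset => j /=.
by apply/ffunP => i; rewrite !ffunE; case: (s i).
Qed.

(** The sum over swaps factors over coordinates, and each factor is the two-term sum of
    [expR_swap_le2]. Hence a fixed pattern has average weight at most 1. *)
Lemma sum_weight_swap t :
  \sum_(s : {ffun 'I_n -> bool}) weight (swap_at s t) <= 2 ^+ n.
Proof.
under eq_bigr => s _.
  rewrite /weight; under eq_bigr => i _ do rewrite ffunE.
  over.
rewrite -(bigA_distr_bigA (fun i b => gap (if b then ((t i).2, (t i).1) else t i))) /=.
rewrite -[X in _ <= _ ^+ X]card_ord -prodr_const; apply: ler_prod => i _.
rewrite !big_bool /= addr_ge0 ?gap_ge0 //= addrC.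
exact: expR_swap_le2.
Qed.

(** Jensen's inequality in the ghost point, one coordinate at a time: the centring is a mean over
    the ghost law, so that mean can be moved outside the exponential. *)
Lemma ghost_bound (j : J) (x : {ffun 'I_n -> E}) :
  expR (50^-1 * (\sum_i v (c j (x i)) -
          \sum_i \sum_e p i e * (v (c j e) + 8^-1 * v (c j e) ^+ 2)))
  <= \sum_(y : {ffun 'I_n -> E}) (\prod_i p i (y i)) *
        weight (pattern j [ffun i => (x i, y i)]).
Proof.
have -> : \sum_(y : {ffun 'I_n -> E}) (\prod_i p i (y i)) *
     weight (pattern j [ffun i => (x i, y i)]) =
   \prod_i \sum_e p i e * gap (c j (x i), c j e).
  rewrite bigA_distr_bigA /=; apply: eq_bigr => y _; rewrite -big_split /=.
  by apply: eq_bigr => i _; rewrite !ffunE.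
rewrite -sumrB mulr_sumr expR_sum; apply: ler_prod => i _; rewrite expR_ge0 /=.
have := jensen_expR R E (p i)
  (fun e => 50^-1 * (v (c j (x i)) - v (c j e) - 8^-1 * v (c j e) ^+ 2)) (p0 i) (p1 i).
apply: le_trans; rewrite ler_expR le_eqVlt; apply/orP; left; apply/eqP => /=.
rewrite -[v (c j (x i)) in LHS]mul1r -(p1 i) mulr_suml -sumrB mulr_sumr.
by apply: eq_bigr => e _; ring.
Qed.

Hypothesis cardN : forall z, (#|patterns z| <= N)%N.

(** The law of the pairs is invariant under swaps, so the sum may be averaged over all of them. By
    [patterns_swap] a swap carries patterns to patterns bijectively, and each averaged weight is at
    most 1, which leaves the number of patterns. *)
Lemma sum_patterns_le :
  \sum_(z : {ffun 'I_n -> E * E}) (\prod_i (p i (z i).1 * p i (z i).2)) *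
     (\sum_(t in patterns z) weight t) <= N%:R.
Proof.
set q := fun z : {ffun 'I_n -> E * E} => \prod_i (p i (z i).1 * p i (z i).2).
have q0 z : 0 <= q z by apply: prodr_ge0 => i _; rewrite mulr_ge0.
rewrite -(ler_pM2l (_ : 0 < 2 ^+ n)) ?exprn_gt0//.
have q1 : \sum_z q z = 1.
  rewrite -(bigA_distr_bigA (fun i e => p i e.1 * p i e.2)) /= big1 // => i _.
  by rewrite -(pair_bigA _ (fun a b => p i a * p i b)) /= -big_distrlr /= p1 mulr1.
have qs s z : q (swap_at s z) = q z.
  by apply: eq_bigr => i _; rewrite ffunE; case: (s i) => //=; rewrite mulrC.
have -> : 2 ^+ n = \sum_(s : {ffun 'I_n -> bool}) 1 :> R.
  by rewrite sumr_const card_ffun card_bool card_ord natrX.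
rewrite mulr_suml.
under eq_bigr => s _.
  rewrite mul1r (reindex_inj (inv_inj (swap_atK s))) /=.
  under eq_bigr => z _.
    rewrite -/(q _) qs patterns_swap big_imset/=; last by move=> ? ? _ _; apply: (inv_inj (swap_atK s)).
    over.
  over.
rewrite exchange_big /=.
apply: (@le_trans _ _ (\sum_z q z * (2 ^+ n * N%:R))); last first.
  by rewrite -mulr_suml q1 mul1r sumr_const card_ffun card_bool card_ord natrX.
apply: ler_sum => z _.
rewrite -mulr_sumr; apply: ler_wpM2l => //.
rewrite exchange_big /=.
apply: (@le_trans _ _ (\sum_(t in patterns z) 2 ^+ n)).
  by apply: ler_sum => t _; exact: sum_weight_swap.
rewrite sumr_const -[leLHS]mulr_natr.
by apply: ler_wpM2l; rewrite ?exprn_ge0// ler_nat.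
Qed.

(** Markov's inequality. The largest weight is bounded by the sum over patterns instead of over
    indices, so indices with the same pattern are paid for once. *)
Lemma ghost_deviation (B : R) :
  \sum_(x : {ffun 'I_n -> E} | [exists j, B < \sum_i v (c j (x i)) -
          \sum_i \sum_e p i e * (v (c j e) + 8^-1 * v (c j e) ^+ 2)])
     \prod_i p i (x i) <= N%:R * expR (- (50^-1 * B)).
Proof.
rewrite expRN ler_pdivlMr ?expR_gt0// mulr_suml.
apply: le_trans sum_patterns_le.
pose f (z : {ffun 'I_n -> E * E}) := ([ffun i => (z i).1] : {ffun 'I_n -> E}, [ffun i => (z i).2] : {ffun 'I_n -> E}).
pose g (z : {ffun 'I_n -> E} * {ffun 'I_n -> E}) := [ffun i => (z.1 i, z.2 i)] : {ffun 'I_n -> E * E}.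
have -> : \sum_(z : {ffun 'I_n -> E * E}) (\prod_i (p i (z i).1 * p i (z i).2)) *
     (\sum_(t in patterns z) weight t) =
   \sum_(x : {ffun 'I_n -> E}) \sum_(y : {ffun 'I_n -> E})
     (\prod_i p i (x i)) * (\prod_i p i (y i)) * \sum_(t in patterns [ffun i => (x i, y i)]) weight t.
  rewrite pair_bigA /= (reindex g) /=; last first.
    exists f => z _; rewrite /f /g.
      by case: z => a b; congr pair; apply/ffunP => i; rewrite !ffunE.
    by apply/ffunP => i; rewrite !ffunE; case: (z i).
  apply: eq_bigr => z _; rewrite -big_split /=; congr (_ * _).
  by apply: eq_bigr => i _; rewrite ffunE.
rewrite [leRHS](bigID (fun x : {ffun 'I_n -> E} => [exists j, B < \sum_i v (c j (x i)) -
          \sum_i \sum_e p i e * (v (c j e) + 8^-1 * v (c j e) ^+ 2)])) /=.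
have w0 z : 0 <= \sum_(t in patterns z) weight t.
  by apply: sumr_ge0 => t _; apply: prodr_ge0 => i _; exact: gap_ge0.
have pp0 (x : {ffun 'I_n -> E}) : 0 <= \prod_i p i (x i) by apply: prodr_ge0.
rewrite -[leLHS]addr0; apply: lerD; last first.
  by apply: sumr_ge0 => x _; apply: sumr_ge0 => y _; rewrite mulr_ge0 ?mulr_ge0.
apply: ler_sum => x /existsP[j jB].
under [leRHS]eq_bigr do rewrite -mulrA.
rewrite -mulr_sumr; apply: ler_wpM2l => //.
apply: (@le_trans _ _ (expR (50^-1 * (\sum_i v (c j (x i)) -
          \sum_i \sum_e p i e * (v (c j e) + 8^-1 * v (c j e) ^+ 2))))).
  by rewrite ler_expR ler_pM2l ?invr_gt0//; exact: ltW.
apply: le_trans (ghost_bound j x) _; apply: ler_sum => y _; apply: ler_wpM2l => //.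
rewrite (bigD1 (pattern j [ffun i => (x i, y i)])) /=; last by apply/imsetP; exists j.
rewrite lerDl; apply: sumr_ge0 => t _; apply: prodr_ge0 => i _; exact: gap_ge0.
Qed.

End Ghost.

Import numFieldNormedType.Exports.
Local Open Scope classical_set_scope.

(** * Patterns of a VC-subgraph class through convex level sets *)

Section Patterns.
Context {R : realType} {W : Type}.

Lemma threshold_shattered_le (Thb : set (W -> R)) (V : nat) (J U : finType)
    (th : J -> W -> R) (z : U -> W * R) (B : {set U}) :
  VC_subgraph_dim_le Thb V -> (forall j, Thb (th j)) ->
  shattersb [set [set u | (z u).2 < th j (z u).1]%SET | j : J]%SET B -> (#|B| <= V)%N.
Proof.
move=> VC hTh /shattersbP sB; rewrite leqNgt; apply/negP => VB.
(* Shattering cuts out each singleton of [B], which forces [z] to separate its points; the image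
   then still has more than [V] elements. *)
have injz : {in B &, injective z}.
  move=> u u' uB u'B e.
  have [X /imsetP[j _ Xj] XB] := sB [set u']%SET ltac:(by rewrite finset.sub1set).
  have : u' \in X :&: B by rewrite XB inE.
  rewrite Xj !inE -e => /andP[zu _].
  have : u \in X :&: B by rewrite Xj !inE zu.
  by rewrite XB inE => /eqP.
apply: (VC (z @` [set` B])).
- by apply: finite_image; exact: finite_finset.
- have /injfunPex[f] : exists2 f : 'I_V.+1 -> W * R,
      set_fun [set: 'I_V.+1] (z @` [set` B]) f & set_inj [set: 'I_V.+1] f.
    exists (fun i => z (enum_val (widen_ord VB i))).
      by move=> i _; exists (enum_val (widen_ord VB i)) => //; exact: enum_valP.
    move=> i i' _ _ /injz e; apply: val_inj.
    by have /enum_val_inj/(congr1 val) := e (enum_valP _) (enum_valP _).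
  exact: inj_card_le f.
move=> G GF; pose A := [set u in B | `[< G (z u) >]]%SET.
have [X /imsetP[j _ Xj] XB] := sB A ltac:(by apply/fintype.subsetP => u; rewrite inE => /andP[]).
exists (subgraph (th j)); first by exists (th j).
apply/seteqP; split => [p [hp [u uB up]]|p Gp].
  have : u \in A by rewrite -XB inE Xj inE up; apply/andP; split => //; exact: hp.
  by rewrite inE => /andP[_ /asboolP]; rewrite up.
have [u uB up] := GF _ Gp; split; last by exists u.
have : u \in A by rewrite inE; apply/andP; split => //; apply/asboolP; rewrite up.
by rewrite -XB Xj !inE up => /andP[].
Qed.

(** On finitely many values a convex predicate is a half-open interval, open on the left and closed
    on the right. Both ends are then tested by strict inequalities, the form in which subgraphs are
    defined. *)
Lemma convex_threshold (J : finType) (t : J -> R) (Q : pred J) :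
  (forall j1 j2 j3, Q j1 -> Q j3 -> t j1 <= t j2 <= t j3 -> Q j2) ->
  exists lohi : R * R, forall j, Q j = (lohi.1 < t j) && ~~ (lohi.2 < t j).
Proof.
move=> cQ; have [Q0|/pred0Pn[j0 Qj0]] := boolP (pred0b Q).
  by exists (0, 0) => j /=; rewrite andbN (pred0P Q0).
pose jM := [arg max_(j > j0 | Q j) t j]%O; pose jm := [arg min_(j < j0 | Q j) t j]%O.
have [QM tM] : Q jM /\ forall j, Q j -> t j <= t jM.
  by rewrite /jM; case: Order.TotalTheory.arg_maxP.
have [Qm tm] : Q jm /\ forall j, Q j -> t jm <= t j.
  by rewrite /jm; case: Order.TotalTheory.arg_minP.
(* [lo] is the largest value strictly below the minimum reached in [Q], or that minimum minus 1 when
   there is none. *)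
have [lo lolt loge] : exists2 lo, lo < t jm & forall j, t j < t jm -> t j <= lo.
  have [L0|/pred0Pn[j1 /= Lj1]] := boolP (pred0b (fun j => t j < t jm)).
    by exists (t jm - 1) => [|j jm']; [rewrite ltrBlDr ltrDl|have := pred0P L0 j; rewrite /= jm'].
  exists (t [arg max_(j > j1 | t j < t jm) t j]%O);
    by case: Order.TotalTheory.arg_maxP.
exists (lo, t jM) => j /=; rewrite -leNgt; apply/idP/andP => [Qj|[lj jM']].
  by split; [exact: lt_le_trans lolt (tm _ Qj)|exact: tM].
apply: (cQ jm j jM) => //; rewrite jM' andbT leNgt; apply/negP => /loge.
by rewrite leNgt lj.
Qed.

(** Two threshold bits per element of [U] determine the membership bit, so the patterns are an image
    of threshold patterns on [U * bool]. Sauer's lemma on this doubled set gives the exponent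
    [#|U| * 2]. *)
Lemma card_convex_patterns (Thb : set (W -> R)) (V : nat) (J U : finType)
    (th : J -> W -> R) (w : U -> W) (P : U -> set R) (a : R) :
  VC_subgraph_dim_le Thb V -> (forall j, Thb (th j)) ->
  (forall u j1 j2 j3, P u (th j1 (w u)) -> P u (th j3 (w u)) ->
    th j1 (w u) <= th j2 (w u) <= th j3 (w u) -> P u (th j2 (w u))) ->
  0 < a <= 1 ->
  #|[set [set u | `[< P u (th j (w u)) >]]%SET | j : J]%SET|%:R <=
    a^-1 ^+ V * (1 + a) ^+ (#|U| * 2).
Proof.
move=> VC hTh cP a01.
have /choice[lohi lohiP] : forall u, exists lohi : R * R, forall j,
    `[< P u (th j (w u)) >] = (lohi.1 < th j (w u)) && ~~ (lohi.2 < th j (w u)).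
  move=> u; apply: (@convex_threshold J (fun j => th j (w u)) (fun j => `[< P u (th j (w u)) >])).
  by move=> j1 j2 j3 /asboolP h1 /asboolP h3 h; apply/asboolP; exact: cP h1 h3 h.
pose z (u : U * bool) := (w u.1, if u.2 then (lohi u.1).1 else (lohi u.1).2).
pose F := [set [set u | (z u).2 < th j (z u).1]%SET | j : J]%SET.
have -> : [set [set u | `[< P u (th j (w u)) >]]%SET | j : J]%SET =
   [set [set u : U | ((u, true) \in X) && ((u, false) \notin X)]%SET | X : {set U * bool} in F]%SET.
  rewrite -imset_comp; apply: eq_imset => j /=.
  by apply/setP => u; rewrite !inE /= lohiP.
apply: (@le_trans _ _ #|F|%:R); first by rewrite ler_nat leq_imset_card.
rewrite -card_bool -card_prod; apply: sauer => // B.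
exact: threshold_shattered_le VC hTh.
Qed.

End Patterns.

Local Open Scope ring_scope.

(** * Hellinger distance and the test function *)

Lemma measurable_funT_sqrt {R : realType} {d} {T : measurableType d} (f : T -> R) :
  measurable_fun setT f -> measurable_fun setT (fun x => Num.sqrt (f x)).
Proof.
move=> mf; apply: (@measurableT_comp _ _ _ _ _ _ (@Num.sqrt R)) => //.
by apply: continuous_measurable_fun; exact: sqrt_continuous.
Qed.

Section Density.
Import HBNNSimple.
Context {R : realType} {d : measure_display} {Y : measurableType d}.
Local Open Scope ereal_scope.

Lemma exists_density (m : {finite_measure set Y -> \bar R}) (P : {finite_measure set Y -> \bar R}) :
  (forall A, P A <= m A) -> exists p : Y -> R, is_density m P p.
Proof.
move=> Pm.
have dom : P `<< m.
  apply/null_content_dominatesP => A mA mA0; apply/eqP; rewrite eq_le measure_ge0 andbT.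
  by rewrite -mA0.
have [f [f0 ffin fint fE]] := radon_nikodym_sigma_finite dom.
exists (fine \o f); split; [|split].
- by apply: measurableT_comp => //; exact: measurable_int fint.
- by move=> y; exact: fine_ge0.
- move=> A mA; rewrite fE//; apply: eq_integral => y _.
  by rewrite /= fineK.
Qed.

Lemma density_ofP (m P : {finite_measure set Y -> \bar R}) :
  (forall A, P A <= m A) -> is_density m P (density_of m P).
Proof. by move=> /exists_density h; exact: ClassicalEpsilon.epsilon_spec. Qed.

(** Change of measure, by monotone convergence from simple functions. It is stated for arbitrary
    measures because [m] is also taken to be the reference measure [nu]. *)
Lemma integral_density (m P : {measure set Y -> \bar R}) (p : Y -> R) (f : Y -> \bar R) :
  is_density m P p -> measurable_fun setT f -> (forall y, 0 <= f y) ->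
  \int[P]_y f y = \int[m]_y (f y * (p y)%:E).
Proof.
move=> [mp [p0 Pp]] mf f0.
pose h := nnsfun_approx measurableT mf.
have hf y : (EFin \o h n) y @[n --> \oo] --> f y by exact: cvg_nnsfun_approx.
have ndh y : {homo (fun n => (h n y)%:E) : a b / (a <= b)%N >-> a <= b}.
  by move=> a b ab; rewrite lee_fin; exact/lefP/nd_nnsfun_approx.
have mh n : measurable_fun setT (EFin \o h n) by exact/measurable_EFinP.
have -> : \int[P]_y f y = limn (fun n => \int[P]_y (h n y)%:E).
  apply/esym/cvg_lim => //.
  rewrite (_ : \int[P]_y f y = \int[P]_y limn (fun n => (h n y)%:E)); last first.
    by apply: eq_integral => y _; apply/esym/cvg_lim => //; exact: hf.
  apply: cvg_monotone_convergence => //.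
  by move=> n y _; rewrite lee_fin.
have -> : \int[m]_y (f y * (p y)%:E) = limn (fun n => \int[m]_y ((h n y)%:E * (p y)%:E)).
  apply/esym/cvg_lim => //.
  rewrite (_ : \int[m]_y _ = \int[m]_y limn (fun n => (h n y)%:E * (p y)%:E)); last first.
    by apply: eq_integral => y _; apply/esym/cvg_lim => //; apply: cvgeZr => //; exact: hf.
  apply: cvg_monotone_convergence => //.
  - by move=> n; apply: emeasurable_funM => //; exact/measurable_EFinP.
  - by move=> n y _; apply: mule_ge0; rewrite lee_fin.
  - by move=> y _ a b ab; apply: lee_wpmul2r; [rewrite lee_fin|exact: ndh].
congr (limn _); apply/funext => n /=.
rewrite integralT_nnsfun sintegralE.
transitivity (\int[m]_y (\sum_(x \in range (h n)) (x * \1_(h n @^-1` [set x]) y)%:E * (p y)%:E)).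
  rewrite ge0_integral_fsum//; last 2 first.
  - move=> x; apply: emeasurable_funM; last exact/measurable_EFinP.
    by apply/measurable_EFinP; apply: measurable_funM => //.
  - move=> x y _ ; apply: mule_ge0; last by rewrite lee_fin.
    by have := nnfun_muleindic_ge0 (h n) x y; rewrite -EFinM.
  apply: eq_fsbigr => x; rewrite inE => -[y0 _ hx].
  have x0 : (0 <= x)%R by rewrite -hx.
  under eq_integral do rewrite EFinM -muleA.
  rewrite ge0_integralZl//; last 2 first.
  - apply: emeasurable_funM; last exact/measurable_EFinP.
    by apply/measurable_EFinP.
  - by move=> y _; rewrite mule_ge0// lee_fin.
  congr (_ * _).
  rewrite Pp// [LHS]integral_mkcond; apply: eq_integral => y _.
  by rewrite epatch_indic muleC.
apply: eq_integral => y _.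
rewrite -ge0_mule_fsuml.
  congr (_ * _).
  rewrite fsumEFin//; congr EFin; apply/esym.
  exact: fimfunE.
by move=> x; have := nnfun_muleindic_ge0 (h n) x y; rewrite -EFinM.
Qed.

End Density.

Section Hellinger.
Context {R : realType} {d : measure_display} {Y : measurableType d}.
Implicit Types P Q : probability Y R.
Local Open Scope ereal_scope.

Section prob_add.
Variables P Q : probability Y R.

(** This is the dominating measure of [hellinger2], written as an [msum] so that it inherits a
    measure structure. *)
Definition prob_add : set Y -> \bar R := msum (fun n => if n is 0%N then P else Q) 2.

HB.instance Definition _ := Measure.on prob_add.

Lemma prob_addE : prob_add = fun A => P A + Q A.
Proof. by apply/funext => A; exact: measure_addE. Qed.

Let prob_add_fin : fin_num_fun prob_add.
Proof. by move=> A mA; rewrite prob_addE fin_numD !fin_num_measure. Qed.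

HB.instance Definition _ := Measure_isFinite.Build _ _ _ prob_add prob_add_fin.

End prob_add.

Lemma density_total (m : set Y -> \bar R) P (p : Y -> R) : is_density m P p ->
  \int[m]_y (p y)%:E = 1.
Proof. by move=> [_ [_ <-//]]; rewrite probability_setT. Qed.

(** The distance does not depend on the dominating measure. Relative to [m], the sum [P + Q] has
    density [p + q], so each density in the definition, multiplied by [p + q], is almost everywhere
    the density relative to [m]; the square of a difference of roots scales by the same factor. *)
Lemma hellinger2E (m : {finite_measure set Y -> \bar R}) P Q (p q : Y -> R) :
  is_density m P p -> is_density m Q q ->
  hellinger2 P Q = (2^-1)%:E * \int[m]_y ((Num.sqrt (p y) - Num.sqrt (q y)) ^+ 2)%:E.
Proof.
move=> dP dQ; rewrite /hellinger2; congr (_ * _).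
have m'E := prob_addE P Q; rewrite -m'E.
pose m' : {finite_measure set Y -> \bar R} := prob_add P Q; rewrite -/m'.
have dP' : is_density m' P (density_of m' P).
  by apply: density_ofP => A; rewrite /= m'E leeDl.
have dQ' : is_density m' Q (density_of m' Q).
  by apply: density_ofP => A; rewrite /= m'E leeDr.
move: (density_of m' P) (density_of m' Q) dP' dQ' => p' q' dP' dQ'.
have [mp [p0 Pp]] := dP; have [mq [q0 Qq]] := dQ.
have [mp' [p'0 Pp']] := dP'; have [mq' [q'0 Qq']] := dQ'.
have dm' : is_density m m' (p \+ q)%R.
  split; first exact: measurable_funD.
  split => [y|A mA]; first by rewrite addr_ge0.
  rewrite -[m' A]/(prob_add P Q A) prob_addE Pp// Qq// -ge0_integralD//; last 4 first.
  - by move=> y _; rewrite lee_fin.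
  - by apply/measurable_EFinP; exact: measurable_funTS.
  - by move=> y _; rewrite lee_fin.
  - by apply/measurable_EFinP; exact: measurable_funTS.
have trans (K : probability Y R) (k k' : Y -> R) : is_density m K k -> is_density m' K k' ->
    ae_eq m setT (EFin \o k) (EFin \o (k' \* (p \+ q))%R).
  move=> dK [mk' [k'0 Kk']]; have [mk [k0 Kk]] := dK.
  apply: integral_ae_eq => //.
  - apply/integrableP; split; first exact/measurable_EFinP.
    under eq_integral do rewrite /= ger0_norm//.
    by rewrite (density_total _ _ _ dK) ltry.
  - by apply/measurable_EFinP; apply: measurable_funM => //; exact: measurable_funD.
  move=> A _ mA; rewrite -Kk// Kk'// [LHS]integral_mkcond.
  rewrite (integral_density _ _ _ _ dm'); last 2 first.
  - by apply/(measurable_restrictT _ _).1 => //; apply/measurable_EFinP; exact: measurable_funTS.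
  - by move=> y; rewrite patchE; case: ifP => // _; rewrite lee_fin.
  rewrite [RHS]integral_mkcond; apply: eq_integral => y _.
  by rewrite !patchE; case: ifP => //=; rewrite mul0e.
rewrite (integral_density _ _ _ _ dm'); last 2 first.
- apply/measurable_EFinP; apply: measurable_funX; apply: measurable_funB;
    exact: measurable_funT_sqrt.
- by move=> y; rewrite lee_fin sqr_ge0.
have aeP := trans _ _ _ dP dP'; have aeQ := trans _ _ _ dQ dQ'.
apply: ge0_ae_eq_integral => //.
- apply: emeasurable_funM; last by apply/measurable_EFinP; exact: measurable_funD.
  apply/measurable_EFinP; apply: measurable_funX; apply: measurable_funB;
    exact: measurable_funT_sqrt.
- apply/measurable_EFinP; apply: measurable_funX; apply: measurable_funB;
    exact: measurable_funT_sqrt.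
- by move=> y _; rewrite -EFinM lee_fin mulr_ge0 ?sqr_ge0 ?addr_ge0.
- by move=> y _; rewrite lee_fin sqr_ge0.
move: aeP aeQ; apply: filterS2 => y /= /(_ I)[hp] /(_ I)[hq] _.
rewrite -EFinM; congr EFin.
have -> : Num.sqrt (p y) = (Num.sqrt (p' y) * Num.sqrt (p y + q y))%R by rewrite -sqrtrM// -hp.
have -> : Num.sqrt (q y) = (Num.sqrt (q' y) * Num.sqrt (p y + q y))%R by rewrite -sqrtrM// -hq.
by rewrite -mulrBl exprMn sqr_sqrtr ?addr_ge0.
Qed.

Lemma hellinger2_ge0 P Q : 0 <= hellinger2 P Q.
Proof.
rewrite /hellinger2 -(prob_addE P Q) mule_ge0 ?lee_fin//.
by apply: integral_ge0 => y _; rewrite lee_fin sqr_ge0.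
Qed.

Lemma hellinger2_le1 P Q : hellinger2 P Q <= 1.
Proof.
have mE := prob_addE P Q.
pose m : {finite_measure set Y -> \bar R} := prob_add P Q.
have [p dP] : exists p, is_density m P p by apply: exists_density => A; rewrite /= mE leeDl.
have [q dQ] : exists q, is_density m Q q by apply: exists_density => A; rewrite /= mE leeDr.
rewrite (hellinger2E _ _ _ _ _ dP dQ); have [mp [p0 _]] := dP; have [mq [q0 _]] := dQ.
apply: (@le_trans _ _ ((2^-1)%:E * \int[m]_y ((p y)%:E + (q y)%:E))).
  apply: lee_wpmul2l; first by rewrite lee_fin.
  apply: ge0_le_integral => //.
  - by move=> y _; rewrite lee_fin sqr_ge0.
  - apply/measurable_EFinP; apply: measurable_funX; apply: measurable_funB;
      exact: measurable_funT_sqrt.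
  - by apply: emeasurable_funD; exact/measurable_EFinP.
  - move=> y _; rewrite -EFinD lee_fin sqrrB !sqr_sqrtr//.
    have := mulr_ge0 (sqrtr_ge0 (p y)) (sqrtr_ge0 (q y)); lra.
rewrite ge0_integralD//; [|by move=> y _; rewrite lee_fin|exact/measurable_EFinP
  |by move=> y _; rewrite lee_fin|exact/measurable_EFinP].
rewrite (density_total _ _ _ dP) (density_total _ _ _ dQ) -EFinD -EFinM lee_fin; lra.
Qed.

End Hellinger.

(** * The function [psi] and its pointwise comparison with Hellinger terms *)

Section Psi.
Context {R : realType}.
Implicit Types x : R.

Lemma psi_norm_le1 x : 0 <= x -> `|psi x| <= 1.
Proof.
move=> x0; rewrite /psi normrM normfV ler_pdivrMr ?normr_gt0 ?gt_eqF; try lra.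
rewrite mul1r (ger0_norm (_ : 0 <= x + 1)); last lra.
by rewrite ler_norml; apply/andP; split; lra.
Qed.

Lemma psi_inv x : 0 < x -> psi x^-1 = - psi x.
Proof. by move=> x0; rewrite /psi; field; rewrite !gt_eqF; lra. Qed.

(** The value plus the quadratic penalty of the ghost-sample bound. *)
Definition tilt (a : R) : R := a + 8^-1 * a ^+ 2.

(* Here [s], [x], [y] are square roots of densities of [P], [Q], [Q'].  One expands
   [s] around [(x + y) / 2]; the terms in [x ^ 2] and [y ^ 2] integrate to the same
   constant.  At [x = y = 0] the value [f] is arbitrary. *)
Lemma test_hellinger_pointwise (f s x y : R) : 0 <= s -> 0 <= x -> 0 <= y ->
  `|f| <= 1 -> f * (x + y) = y - x ->
  (1 + tilt f) * s ^+ 2 + 16^-1 * (s - y) ^+ 2 + 4^-1 * x ^+ 2 <=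
  s ^+ 2 + 15 / 8 * (s - x) ^+ 2 + 4^-1 * y ^+ 2.
Proof.
move=> s0 x0 y0 f1 fxy; rewrite /tilt.
pose u := s - x; pose v := s - y.
have fs : f * s ^+ 2 = f * (4^-1 * (u + v) ^+ 2) + 2^-1 * u ^+ 2 - 2^-1 * v ^+ 2
                       + 4^-1 * (y ^+ 2 - x ^+ 2).
  have -> : f * s ^+ 2 = f * (4^-1 * (u + v) ^+ 2) + s * (f * (x + y)) -
    4^-1 * ((f * (x + y)) * (x + y)) by rewrite /u /v; field.
  by rewrite fxy /u /v; field.
have fss : (f * s) ^+ 2 <= u ^+ 2 + v ^+ 2.
  have -> : f * s = f * (2^-1 * (u + v)) + 2^-1 * (u - v).
    have -> : f * s = f * (2^-1 * (u + v)) + 2^-1 * (f * (x + y)) by rewrite /u /v; field.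
    by rewrite fxy /u /v; field.
  have f2 : f ^+ 2 <= 1 by rewrite -(@ler_sqrt _ (f ^+ 2)) // sqrtr_sqr sqrtr1.
  set g := 2^-1 * (u + v); set e := 2^-1 * (u - v).
  rewrite (_ : u ^+ 2 + v ^+ 2 = 2 * g ^+ 2 + 2 * e ^+ 2); last by rewrite /g /e; field.
  have : (f * g + e) ^+ 2 <= 2 * (f * g) ^+ 2 + 2 * e ^+ 2.
    by rewrite -subr_ge0 [X in 0 <= X](_ : _ = (f * g - e) ^+ 2) ?sqr_ge0 //; ring.
  have : (f * g) ^+ 2 <= g ^+ 2 by rewrite exprMn ler_piMl ?sqr_ge0.
  lra.
(* The uneven split leaves a negative total for [v ^+ 2]: the coefficients add up to 5/4 + 1/2 + 1/8
   = 15/8 for [u ^+ 2] and 5/16 - 1/2 + 1/8 = -1/16 for [v ^+ 2]. *)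
have f12 : f * (4^-1 * (u + v) ^+ 2) <= 5 / 4 * u ^+ 2 + 5 / 16 * v ^+ 2.
  apply: (@le_trans _ _ (4^-1 * (u + v) ^+ 2)).
    by apply: ler_piMl; [rewrite mulr_ge0 ?sqr_ge0|exact: le_trans (ler_norm _) f1].
  rewrite -subr_ge0 [X in 0 <= X](_ : _ = (u - 4^-1 * v) ^+ 2) ?sqr_ge0 //.
  by field.
rewrite -/u -/v.
have -> : (1 + (f + 8^-1 * f ^+ 2)) * s ^+ 2 = s ^+ 2 + f * s ^+ 2 + 8^-1 * (f * s) ^+ 2 by ring.
rewrite fs; lra.
Qed.

(** This is the relation [f * (x + y) = y - x] of [test_hellinger_pointwise] when the second root is
    a multiple of the first. Being free of division by [x], it persists where the density
    vanishes. *)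
Lemma psi_ratio x y : 0 <= x -> psi (Num.sqrt y) * (x + Num.sqrt y * x) = Num.sqrt y * x - x.
Proof.
move=> x0; rewrite /psi; field.
by rewrite gt_eqF// ltr_wpDl// sqrtr_ge0.
Qed.

Lemma tilt_ge0 (a : R) : `|a| <= 1 -> 0 <= 1 + tilt a.
Proof. by rewrite ler_norml /tilt => /andP[a1 a2]; have := sqr_ge0 a; lra. Qed.

Lemma measurable_funT_psi {d} {T : measurableType d} (f : T -> R) :
  measurable_fun setT f -> (forall t, 0 <= f t) -> measurable_fun setT (fun t => psi (f t)).
Proof.
move=> mf f0; apply: measurable_funM; first exact: measurable_funB.
apply: (@measurable_comp _ _ _ _ _ _ [set x : R | x != 0] (@GRing.inv R)).
- by apply: open_measurable; exact: (@open_neq R 0).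
- by move=> _ [y _ <-] /=; rewrite gt_eqF// ltr_wpDl.
- apply: open_continuous_measurable_fun; first exact: (@open_neq R 0).
  by move=> x; rewrite inE => x0; exact: inv_continuous.
- exact: measurable_funD.
Qed.

End Psi.

Section TestInequality.
Context {R : realType} {d : measure_display} {Y : measurableType d}.
Implicit Types P Q : probability Y R.
Local Open Scope ereal_scope.

Lemma hellinger2_test P Q Q' (l : Y -> R) :
  measurable_fun setT l -> (forall y, 0 <= l y)%R ->
  (forall A, measurable A -> Q' A = \int[Q]_(y in A) (l y)%:E) ->
  \int[P]_y (1 + tilt (psi (Num.sqrt (l y))))%:E + (8^-1)%:E * hellinger2 P Q' <=
  1 + (15 / 4)%:E * hellinger2 P Q.
Proof.
move=> ml l0 Q'l.
have mE := prob_addE P Q.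
pose m : {finite_measure set Y -> \bar R} := prob_add P Q.
have [p dP] : exists p, is_density m P p by apply: exists_density => A; rewrite /= mE leeDl.
have [q dQ] : exists q, is_density m Q q by apply: exists_density => A; rewrite /= mE leeDr.
have [mp [p0 _]] := dP; have [mq [q0 _]] := dQ.
have dQ' : is_density m Q' (l \* q)%R.
  split; first exact: measurable_funM.
  split => [y|A mA]; first exact: mulr_ge0.
  rewrite Q'l// integral_mkcond (integral_density _ _ _ _ dQ); last 2 first.
  - by apply/(measurable_restrictT _ _).1 => //; apply/measurable_EFinP; exact: measurable_funTS.
  - by move=> y; rewrite patchE; case: ifP => // _; rewrite lee_fin.
  rewrite [RHS]integral_mkcond; apply: eq_integral => y _.
  by rewrite !patchE; case: ifP => //=; rewrite mul0e.
rewrite (hellinger2E _ _ _ _ _ dP dQ') (hellinger2E _ _ _ _ _ dP dQ).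
have msq (f : Y -> R) : measurable_fun setT f -> measurable_fun setT (fun y => Num.sqrt (f y)).
  exact: measurable_funT_sqrt.
have mpsi : measurable_fun setT (fun y => psi (Num.sqrt (l y))).
  by apply: measurable_funT_psi => [|y]; [exact: msq|exact: sqrtr_ge0].
have mt : measurable_fun setT (fun y => (1 + tilt (psi (Num.sqrt (l y))))%R).
  apply: measurable_funD => //; apply: measurable_funD => //.
  by apply: measurable_funM => //; exact: measurable_funX.
have t0 y : (0 <= 1 + tilt (psi (Num.sqrt (l y))))%R.
  by apply: tilt_ge0; apply: psi_norm_le1; exact: sqrtr_ge0.
have mh (f : Y -> R) : measurable_fun setT f ->
   measurable_fun setT (fun y => (Num.sqrt (p y) - Num.sqrt (f y)) ^+ 2)%R.
  by move=> mf; apply: measurable_funX; apply: measurable_funB; exact: msq.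
have mlq : measurable_fun setT (l \* q)%R by exact: measurable_funM.
have intZ (k : R) (f : Y -> R) : (0 <= k)%R -> measurable_fun setT f -> (forall y, 0 <= f y)%R ->
    k%:E * \int[m]_y (f y)%:E = \int[m]_y (k * f y)%:E.
  move=> k0 mf f0; under [RHS]eq_integral do rewrite EFinM.
  rewrite ge0_integralZl//; first exact/measurable_EFinP.
  by move=> y _; rewrite lee_fin.
have intD (f g : Y -> R) : measurable_fun setT f -> (forall y, 0 <= f y)%R ->
    measurable_fun setT g -> (forall y, 0 <= g y)%R ->
    \int[m]_y (f y)%:E + \int[m]_y (g y)%:E = \int[m]_y (f y + g y)%:E.
  move=> mf f0 mg g0; under [RHS]eq_integral do rewrite EFinD.
  by rewrite ge0_integralD//; try exact/measurable_EFinP; move=> y _; rewrite lee_fin.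
rewrite (integral_density _ _ _ _ dP)//; last exact/measurable_EFinP.
(* A quarter is added to both sides and written as the integral of a quarter of the density of [Q]
   on the left and of [Q'] on the right. The two sides then compare pointwise, with no subtraction
   of integrals. *)
have h4 : (4^-1 : R)%:E \is a fin_num by [].
rewrite -(leeD2rE _ _ h4).
under eq_integral do rewrite -EFinM.
rewrite !muleA -!EFinM.
have e1 : (4^-1)%:E = \int[m]_y (4^-1 * q y)%:E :> \bar R.
  by rewrite -intZ// (density_total _ _ _ dQ) mule1.
have e2 : (4^-1)%:E = \int[m]_y (4^-1 * (l \* q)%R y)%:E :> \bar R.
  by rewrite -intZ// ?(density_total _ _ _ dQ') ?mule1// => y; exact: mulr_ge0.
rewrite (intZ (8^-1 / 2)%R); [|lra|exact: mh|by move=> y; exact: sqr_ge0].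
rewrite (intZ (15 / 4 / 2)%R); [|lra|exact: mh|by move=> y; exact: sqr_ge0].
pose A y := ((1 + tilt (psi (Num.sqrt (l y)))) * p y)%R.
pose B y := (8^-1 / 2 * (Num.sqrt (p y) - Num.sqrt ((l \* q) y)) ^+ 2)%R.
pose C y := (4^-1 * q y)%R.
pose B' y := (15 / 4 / 2 * (Num.sqrt (p y) - Num.sqrt (q y)) ^+ 2)%R.
pose C' y := (4^-1 * (l \* q)%R y)%R.
have [mA A0] : measurable_fun setT A /\ forall y, (0 <= A y)%R.
  by split=> [|y]; [exact: measurable_funM|exact: mulr_ge0].
have [mB B0] : measurable_fun setT B /\ forall y, (0 <= B y)%R.
  split=> [|y]; first by apply: measurable_funM => //; exact: mh.
  by rewrite mulr_ge0 ?sqr_ge0//; lra.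
have [mC C0] : measurable_fun setT C /\ forall y, (0 <= C y)%R.
  by split=> [|y]; [exact: measurable_funM|exact: mulr_ge0].
have [mB' B'0] : measurable_fun setT B' /\ forall y, (0 <= B' y)%R.
  split=> [|y]; first by apply: measurable_funM => //; exact: mh.
  by rewrite mulr_ge0 ?sqr_ge0//; lra.
have [mC' C'0] : measurable_fun setT C' /\ forall y, (0 <= C' y)%R.
  by split=> [|y]; [exact: measurable_funM|rewrite !mulr_ge0].
have [mAB AB0] : measurable_fun setT (A \+ B)%R /\ forall y, (0 <= (A \+ B) y)%R.
  by split=> [|y]; [exact: measurable_funD|exact: addr_ge0].
have [mAB' AB'0] : measurable_fun setT (p \+ B')%R /\ forall y, (0 <= (p \+ B') y)%R.
  by split=> [|y]; [exact: measurable_funD|exact: addr_ge0].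
rewrite [in leLHS]e1 [in leRHS]e2 -(density_total _ _ _ dP).
rewrite (intD _ _ mA A0 mB B0) (intD _ _ mAB AB0 mC C0).
rewrite (intD _ _ mp p0 mB' B'0) (intD _ _ mAB' AB'0 mC' C'0).
apply: ge0_le_integral => //.
- by move=> y _; rewrite lee_fin addr_ge0.
- by apply/measurable_EFinP; exact: measurable_funD.
- by apply/measurable_EFinP; exact: measurable_funD.
move=> y _; rewrite lee_fin /A /B /C /B' /C' /=.
have := @test_hellinger_pointwise R (psi (Num.sqrt (l y))) (Num.sqrt (p y)) (Num.sqrt (q y))
  (Num.sqrt (l y) * Num.sqrt (q y)) (sqrtr_ge0 _) (sqrtr_ge0 _)
  (mulr_ge0 (sqrtr_ge0 _) (sqrtr_ge0 _)) (psi_norm_le1 _ (sqrtr_ge0 _)) (psi_ratio _ _ (sqrtr_ge0 _)).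
rewrite exprMn !sqr_sqrtr// sqrtrM//.
set a := ((1 + _) * _)%R; set b := ((_ - _ * _) ^+ 2)%R; set c := ((_ - _) ^+ 2)%R.
set e := (l y * q y)%R; lra.
Qed.

End TestInequality.

(** * Exponential families *)

Section DensityProbability.
Context {R : realType} {d : measure_display} {Y : measurableType d}.
Variables (nu : {measure set Y -> \bar R}) (f : Y -> R).
Hypotheses (mf : measurable_fun setT f) (f0 : forall y, 0 <= f y)
  (f1 : (\int[nu]_y (f y)%:E = 1)%E).

(* The phantom arguments let canonical structure inference recover the hypotheses. *)
Definition density_prob of measurable_fun setT f & (forall y, 0 <= f y)
  & (\int[nu]_y (f y)%:E = 1)%E : set Y -> \bar R :=
  fun A => (\int[nu]_(y in A) (f y)%:E)%E.

Let mu := density_prob mf f0 f1.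

Let mu0 : mu set0 = 0%E. Proof. exact: integral_set0. Qed.

Let mu_ge0 A : (0 <= mu A)%E.
Proof. by apply: integral_ge0 => y _; rewrite lee_fin. Qed.

Let mu_sigma_additive : semi_sigma_additive mu.
Proof.
move=> F mF tF mUF; rewrite /mu /density_prob ge0_integral_bigcup//.
- by apply: is_cvg_ereal_nneg_natsum_cond => i _ _; apply: integral_ge0 => y _; rewrite lee_fin.
- by apply/measurable_EFinP; exact: measurable_funTS.
- by move=> y _; rewrite lee_fin.
Qed.

HB.instance Definition _ := isMeasure.Build _ _ _ mu mu0 mu_ge0 mu_sigma_additive.

HB.instance Definition _ := Measure_isProbability.Build _ _ _ mu f1.

End DensityProbability.

Section SigmaFinite.
Context {R : realType} {d : measure_display} {Y : measurableType d}.
Variable nu : {measure set Y -> \bar R}.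

(** A copy of [nu] whose phantom argument lets it carry the sigma-finite structure required by
    Tonelli's theorem. *)
Definition sigma_finite_copy of sigma_finite setT nu : set Y -> \bar R := nu.

Hypothesis sf : sigma_finite setT nu.

HB.instance Definition _ := Measure.copy (sigma_finite_copy sf) nu.

HB.instance Definition _ := Measure_isSigmaFinite.Build _ _ _ (sigma_finite_copy sf) sf.

End SigmaFinite.

Section ExponentialFamily.
Context {R : realType} {d : measure_display} {Y : measurableType d}.
Variables (nu : {measure set Y -> \bar R}) (S : Y -> R).
Hypotheses (mS : measurable_fun setT S)
  (Sc : ~ (exists c : R, {ae nu, forall y, S y = c})).

Local Notation Z t := (\int[nu]_y (expR (t * S y))%:E)%E.

Let mexp t : measurable_fun setT (fun y => expR (t * S y)).
Proof. by apply: measurableT_comp => //; exact: measurable_funM. Qed.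

(** A positive function with zero integral forces [nu] to be null, and then [S] would be almost
    everywhere constant. *)
Lemma laplace_gt0 t : (0 < Z t)%E.
Proof.
rewrite lt_neqAle; apply/andP; split; last first.
  by apply: integral_ge0 => y _; rewrite lee_fin expR_ge0.
apply/eqP => /esym Z0; apply: Sc; exists 0.
have : (\int[nu]_y `|(expR (t * S y))%:E| = 0)%E.
  by rewrite -[RHS]Z0; apply: eq_integral => y _; rewrite /= ger0_norm ?expR_ge0.
move=> /(ae_eq_integral_abs nu measurableT _).1 h.
have /h : measurable_fun setT (fun y => (expR (t * S y))%:E) by exact/measurable_EFinP.
apply: filterS => y /(_ I) /eqP; rewrite eqe gt_eqF ?expR_gt0//.
Qed.

Lemma fine_laplace_gt0 t : (Z t < +oo)%E -> 0 < fine (Z t).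
Proof. by move=> Zt; rewrite fine_gt0// laplace_gt0. Qed.

Lemma fine_laplaceK t : (Z t < +oo)%E -> (fine (Z t))%:E = Z t.
Proof. by move=> Zt; rewrite fineK// gt0_fin_numE ?laplace_gt0. Qed.

Lemma qdensE t y : (Z t < +oo)%E -> qdens nu S t y = expR (t * S y) / fine (Z t).
Proof.
move=> Zt; rewrite /qdens /logpart expRB lnK ?posrE ?fine_laplace_gt0//.
by rewrite mulrC [S y * t]mulrC mulrC.
Qed.

Lemma qdens_gt0 t y : 0 < qdens nu S t y.
Proof. exact: expR_gt0. Qed.

Lemma measurable_qdens t : measurable_fun setT (qdens nu S t).
Proof.
apply: measurableT_comp => //; apply: measurable_funB => //.
exact: measurable_funM.
Qed.

Lemma integral_qdens t : (Z t < +oo)%E -> (\int[nu]_y (qdens nu S t y)%:E = 1)%E.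
Proof.
move=> Zt; under eq_integral do rewrite qdensE// mulrC EFinM.
rewrite ge0_integralZl//; last 2 first.
- exact/measurable_EFinP.
- by rewrite lee_fin invr_ge0 ltW// fine_laplace_gt0.
rewrite -fine_laplaceK// -EFinM mulVf// gt_eqF// fine_laplace_gt0//.
Qed.

Definition qprob t (Zt : (Z t < +oo)%E) : probability Y R :=
  density_prob nu _ (measurable_qdens t) (fun y => ltW (qdens_gt0 t y)) (integral_qdens t Zt).

Lemma qprobE t (Zt : (Z t < +oo)%E) : Qexp nu S t = qprob t Zt.
Proof. by []. Qed.

Lemma qprob_is_density t (Zt : (Z t < +oo)%E) : is_density nu (qprob t Zt) (qdens nu S t).
Proof.
split; first exact: measurable_qdens.
by split => // y; rewrite ltW// qdens_gt0.
Qed.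

Lemma qexp_test (P : probability Y R) t t' : (Z t < +oo)%E -> (Z t' < +oo)%E ->
  (\int[P]_y (1 + tilt (psi (Num.sqrt (qdens nu S t' y / qdens nu S t y))))%:E +
     (8^-1)%:E * hellinger2 P (Qexp nu S t') <=
   1 + (15 / 4)%:E * hellinger2 P (Qexp nu S t))%E.
Proof.
move=> Zt Zt'; rewrite (qprobE _ Zt) (qprobE _ Zt').
have ml : measurable_fun setT (fun y => qdens nu S t' y / qdens nu S t y).
  rewrite (_ : (fun y => _) = (fun y => expR ((S y * t' - logpart nu S t') - (S y * t - logpart nu S t)))).
    apply: measurableT_comp => //; apply: measurable_funB; apply: measurable_funB => //;
      exact: measurable_funM.
  by apply/funext => y; rewrite /qdens -expRN -expRD.
have l0 y : 0 <= qdens nu S t' y / qdens nu S t y by rewrite divr_ge0// ltW// qdens_gt0.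
apply: hellinger2_test => // A mA.
rewrite [RHS]integral_mkcond (integral_density _ _ _ _ (qprob_is_density t Zt)); last 2 first.
- by apply/(measurable_restrictT _ _).1 => //; apply/measurable_EFinP; exact: measurable_funTS.
- by move=> y; rewrite patchE; case: ifP => // _; rewrite lee_fin.
rewrite [LHS]integral_mkcond; apply: eq_integral => y _.
rewrite !patchE; case: ifP => _; last by rewrite mul0e.
by rewrite /= -EFinM divfK// gt_eqF// qdens_gt0.
Qed.

Lemma expR_convex_weights (x1 x2 x3 a b : R) : 0 <= a -> 0 <= b ->
  a * (x2 - x1) = b * (x3 - x2) ->
  (a + b) * expR x2 <= a * expR x1 + b * expR x3.
Proof.
move=> a0 b0 e.
have h x : expR x2 * (1 + (x - x2)) <= expR x.
  rewrite -[x in leRHS](subrKC x2) expRD ler_wpM2l ?expR_ge0//.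
  exact: expR_ge1Dx.
apply: le_trans (lerD (ler_wpM2l a0 (h x1)) (ler_wpM2l b0 (h x3))).
rewrite -subr_ge0 [X in 0 <= X](_ : _ = expR x2 * (b * (x3 - x2) - a * (x2 - x1))); last by ring.
by rewrite e subrr mulr0.
Qed.

(** The reciprocal of [qdens nu S t y] is the integral of [expR (t * (S y' - S y))] over [y'], which
    is convex in [t], so its sublevel sets are intervals. *)
Lemma qdens_superlevel_convex c y t1 t2 t3 :
  (Z t1 < +oo)%E -> (Z t2 < +oo)%E -> (Z t3 < +oo)%E -> t1 <= t2 <= t3 ->
  c < qdens nu S t1 y -> c < qdens nu S t3 y -> c < qdens nu S t2 y.
Proof.
move=> Z1 Z2 Z3 /andP[t12 t23].
have [c0 _ _|c0] := ltP c 0; first exact: lt_trans c0 (qdens_gt0 _ _).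
have [->//|t12n] := eqVneq t1 t2.
have {}t12 : t1 < t2 by rewrite lt_neqAle t12n.
rewrite !qdensE//; set z1 := fine (Z t1); set z2 := fine (Z t2); set z3 := fine (Z t3).
rewrite !ltr_pdivlMr ?fine_laplace_gt0// => h1 h3.
set s := S y in h1 h3 *.
(* Convexity of that reciprocal at [t2], multiplied through by [expR (t2 * s)]. *)
have zle : ((t3 - t2) + (t2 - t1)) * z2 <=
    (t3 - t2) * (expR ((t2 - t1) * s) * z1) + (t2 - t1) * (expR ((t2 - t3) * s) * z3).
  have a1 : 0 <= (t3 - t2) * expR ((t2 - t1) * s) by rewrite mulr_ge0 ?expR_ge0//; lra.
  have a3 : 0 <= (t2 - t1) * expR ((t2 - t3) * s) by rewrite mulr_ge0 ?expR_ge0//; lra.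
  rewrite !mulrA -lee_fin EFinD !EFinM !fine_laplaceK// -!EFinM.
  have e0 y' : (0 <= (expR (t1 * S y'))%:E)%E by rewrite lee_fin expR_ge0.
  have a1' : (0 <= ((t3 - t2) * expR ((t2 - t1) * s))%:E)%E by rewrite lee_fin.
  have a3' : (0 <= ((t2 - t1) * expR ((t2 - t3) * s))%:E)%E by rewrite lee_fin.
  have a2' : (0 <= (t3 - t2 + (t2 - t1))%:E)%E by rewrite lee_fin; lra.
  have mE t : measurable_fun setT (fun y => (expR (t * S y))%:E) by exact/measurable_EFinP.
  have E0 t y' : setT y' -> (0 <= (expR (t * S y'))%:E)%E by rewrite lee_fin expR_ge0.
  rewrite -(ge0_integralZl nu measurableT (mE t2) (E0 t2) a2').
  rewrite -(ge0_integralZl nu measurableT (mE t1) (E0 t1) a1').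
  rewrite -(ge0_integralZl nu measurableT (mE t3) (E0 t3) a3').
  rewrite -ge0_integralD//; last 4 first.
  - by move=> y' _; rewrite mule_ge0// lee_fin// expR_ge0.
  - by apply/measurable_EFinP; exact: measurable_funM.
  - by move=> y' _; rewrite mule_ge0// lee_fin// expR_ge0.
  - by apply/measurable_EFinP; exact: measurable_funM.
  apply: ge0_le_integral => //.
  - by move=> y' _; rewrite mule_ge0// lee_fin ?expR_ge0//; lra.
  - by apply/measurable_EFinP; exact: measurable_funM.
  - by apply: emeasurable_funD; apply/measurable_EFinP; exact: measurable_funM.
  move=> y' _; rewrite -!EFinM -EFinD lee_fin -!mulrA -!expRD.
  apply: expR_convex_weights; [lra|lra|ring].
rewrite -(ltr_pM2l (_ : 0 < (t3 - t2) + (t2 - t1))); last lra.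
rewrite mulrCA; apply: le_lt_trans (ler_wpM2l c0 zle) _.
rewrite [X in X < _](_ : _ = (t3 - t2) * (expR ((t2 - t1) * s) * (c * z1)) +
   (t2 - t1) * (expR ((t2 - t3) * s) * (c * z3))); last by ring.
have k1 : expR ((t2 - t1) * s) * (c * z1) < expR (t2 * s).
  rewrite (_ : t2 * s = (t2 - t1) * s + t1 * s); last by ring.
  by rewrite expRD ltr_pM2l ?expR_gt0.
have k3 : expR ((t2 - t3) * s) * (c * z3) < expR (t2 * s).
  rewrite (_ : t2 * s = (t2 - t3) * s + t3 * s); last by ring.
  by rewrite expRD ltr_pM2l ?expR_gt0.
rewrite [ltRHS]mulrDl; apply: ler_ltD.
  by apply: ler_wpM2l; [lra|exact: ltW].
by rewrite ltr_pM2l; [|lra].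
Qed.

Lemma measurable_laplace : sigma_finite setT nu -> measurable_fun setT (fun t : R => Z t).
Proof.
move=> sf.
have mf : measurable_fun setT (fun ty : R * Y => (expR (ty.1 * S ty.2))%:E).
  apply/measurable_EFinP; apply: measurableT_comp => //; apply: measurable_funM => //.
  exact: measurableT_comp.
have f0 (ty : R * Y) : (0 <= (expR (ty.1 * S ty.2))%:E)%E by rewrite lee_fin expR_ge0.
exact: (measurable_fun_fubini_tonelli_F (m2 := sigma_finite_copy nu sf) _ mf f0).
Qed.

End ExponentialFamily.

(** * Lower integrals, laws and disintegration *)

Section LowerIntegral.
Import HBNNSimple.
Context {R : realType} {d : measure_display} {T : measurableType d}.
Variable mu : {measure set T -> \bar R}.
Local Open Scope ereal_scope.
Implicit Types f g : T -> \bar R.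

(** The integral of a nonnegative function is the supremum over simple functions below it,
    measurable or not. *)
Lemma lower_integral_le f (c : \bar R) : (forall x, 0 <= f x) ->
  (forall h : {nnsfun T >-> R}, (forall x, (h x)%:E <= f x) -> \int[mu]_x (h x)%:E <= c) ->
  \int[mu]_x f x <= c.
Proof.
move=> f0 hc; rewrite ge0_integralTE//; apply: ge_ereal_sup => _ [h hf <-].
by rewrite -integralT_nnsfun; exact: hc.
Qed.

Lemma lower_integral_mono f g : (forall x, 0 <= f x <= g x) ->
  \int[mu]_x f x <= \int[mu]_x g x.
Proof.
move=> fg; have f0 x : 0 <= f x by have /andP[] := fg x.
have g0 x : 0 <= g x by have /andP[] := fg x; exact: le_trans.
apply: lower_integral_le => // h hf; rewrite (ge0_integralTE _ g0) integralT_nnsfun.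
apply: ereal_sup_ubound; exists h => // x /=.
by apply: le_trans (hf x) _; have /andP[] := fg x.
Qed.

(** If a simple [h] lies below [g], then [f + h] lies below [f + g], and additivity holds for
    [f + h]. Finiteness allows the integral of [f] to be moved across the inequality. *)
Lemma lower_integralD f g : measurable_fun setT f -> (forall x, 0 <= f x) ->
  \int[mu]_x f x \is a fin_num -> (forall x, 0 <= g x) ->
  \int[mu]_x f x + \int[mu]_x g x <= \int[mu]_x (f x + g x).
Proof.
move=> mf f0 ffin g0; rewrite addeC -leeBrDr//.
apply: lower_integral_le => // h hg; rewrite leeBrDr// -ge0_integralD//.
- apply: lower_integral_mono => x; rewrite addeC leeD2l// andbT adde_ge0//.
  by rewrite lee_fin.
- by move=> x _; rewrite lee_fin.
- exact/measurable_EFinP.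
Qed.

(** A simple function [h] below [k + f] gives [max (h - k, 0)] below [f], which is still measurable;
    this is the direction opposite to superadditivity. *)
Lemma lower_integral_cstD (k : R) f : mu setT = 1 -> (0 <= k)%R -> (forall x, 0 <= f x) ->
  \int[mu]_x (k%:E + f x) <= k%:E + \int[mu]_x f x.
Proof.
move=> mu1 k0 f0; apply: lower_integral_le => [x|h hf]; first by rewrite adde_ge0 ?lee_fin.
have mh : measurable_fun setT (fun x => (Num.max (h x - k) 0)%:E).
  by apply/measurable_EFinP; apply: measurable_maxr => //; exact: measurable_funB.
have h0 x : 0 <= (Num.max (h x - k) 0)%:E by rewrite lee_fin le_max lexx orbT.
apply: (@le_trans _ _ (\int[mu]_x (k%:E + (Num.max (h x - k) 0)%:E))).
  apply: lower_integral_mono => x; rewrite lee_fin fun_ge0/= -EFinD lee_fin.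
  by rewrite -lerBlDl le_max lexx.
rewrite ge0_integralD ?lee_fin// integral_cst// mu1 mule1 leeD2l//.
apply: lower_integral_mono => x; rewrite h0/= EFin_max ge_max f0 andbT.
by rewrite EFinB leeBlDl// hf.
Qed.

Lemma lower_integralZ (c : R) f : (0 < c)%R -> (forall x, 0 <= f x) ->
  \int[mu]_x (c%:E * f x) = c%:E * \int[mu]_x f x.
Proof.
have half (k : R) g : (0 < k)%R -> (forall x, 0 <= g x) ->
    \int[mu]_x (k%:E * g x) <= k%:E * \int[mu]_x g x.
  move=> k0 g0; apply: lower_integral_le => [x|h hg].
    by rewrite mule_ge0// lee_fin ltW.
  rewrite -lee_pdivrMl// -ge0_integralZl//; last 3 first.
  - exact/measurable_EFinP.
  - by move=> x _; rewrite lee_fin.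
  - by rewrite lee_fin invr_ge0 ltW.
  apply: lower_integral_mono => x; rewrite mule_ge0 ?lee_fin ?invr_ge0 ?(ltW k0)//=.
  by rewrite lee_pdivrMl.
move=> c0 f0; apply/eqP; rewrite eq_le half//=.
rewrite -lee_pdivlMl//; apply: le_trans (half _ _ _ _); rewrite ?invr_gt0//.
  apply: lower_integral_mono => x; rewrite f0/= muleA -EFinM mulVf ?gt_eqF//.
  by rewrite mul1e.
by move=> x; rewrite mule_ge0// lee_fin ltW.
Qed.

Lemma lower_integral_affine (a b k : R) (G H H' : T -> \bar R) : mu setT = 1 ->
  (0 < a)%R -> (0 < b)%R -> (0 <= k)%R -> measurable_fun setT G ->
  (forall x, 0 <= G x) -> \int[mu]_x G x \is a fin_num ->
  (forall x, 0 <= H x) -> (forall x, 0 <= H' x) ->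
  (forall x, G x + a%:E * H x <= k%:E + b%:E * H' x) ->
  \int[mu]_x G x + a%:E * \int[mu]_x H x <= k%:E + b%:E * \int[mu]_x H' x.
Proof.
move=> mu1 a0 b0 k0 mG G0 Gfin H0 H'0 GH.
have aH0 x : 0 <= a%:E * H x by rewrite mule_ge0// lee_fin ltW.
have bH0 x : 0 <= b%:E * H' x by rewrite mule_ge0// lee_fin ltW.
rewrite -!lower_integralZ//; apply: le_trans (lower_integralD _ _ mG G0 Gfin aH0) _.
apply: le_trans (lower_integral_cstD _ _ mu1 k0 bH0).
by apply: lower_integral_mono => x; rewrite GH adde_ge0.
Qed.

End LowerIntegral.

Section Law.
Context {R : realType} {dO d : measure_display} {Omega : measurableType dO} {T : measurableType d}.
Variables (P : probability Omega R) (X : Omega -> T) (mX : measurable_fun setT X).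

Definition law : probability T R :=
  distribution P (HB.pack X (isMeasurableFun.Build _ _ _ _ _ mX) : {mfun Omega >-> T}).

Lemma lawE A : law A = P (X @^-1` A).
Proof. by []. Qed.

End Law.

Section Disintegration.
Context {R : realType} {dW dY : measure_display} {W : measurableType dW} {Y : measurableType dY}.
Variables (mu : {measure set W -> \bar R}) (Q : W -> probability Y R).
Hypothesis mQ : forall B, measurable B -> measurable_fun setT (fun w => Q w B : \bar R).

Definition cond_kernel of (forall B, measurable B -> measurable_fun setT (fun w => Q w B : \bar R)) :
  W -> {measure set Y -> \bar R} := Q.

HB.instance Definition _ := isKernel.Build _ _ _ _ _ (cond_kernel mQ) mQ.

HB.instance Definition _ := Kernel_isProbability.Build _ _ _ _ _ (cond_kernel mQ)
  (fun w => probability_setT (Q w)).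

Lemma measurable_section_prob (C : set (W * Y)) : measurable C ->
  measurable_fun setT (fun w => Q w (xsection C w)).
Proof.
by move=> mC; apply: (measurable_fun_xsection_finite_kernel (cond_kernel mQ)); rewrite inE.
Qed.

Definition joint of (forall B, measurable B -> measurable_fun setT (fun w => Q w B : \bar R)) :
  set (W * Y) -> \bar R :=
  fun C => (\int[mu]_w Q w (xsection C w))%E.

Let joint0 : joint mQ set0 = 0%E.
Proof. by apply: integral0_eq => w _; rewrite xsection0 measure0. Qed.

Let joint_ge0 C : (0 <= joint mQ C)%E.
Proof. by apply: integral_ge0 => w _; exact: measure_ge0. Qed.

Let joint_sigma_additive : semi_sigma_additive (joint mQ).
Proof.
move=> F mF tF mUF; rewrite /joint.
rewrite (_ : (\int[mu]_w Q w (xsection (\bigcup_n F n) w))%E =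
   (\int[mu]_w \sum_(n <oo) Q w (xsection (F n) w))%E); last first.
  apply: eq_integral => w _; rewrite xsection_bigcup.
  apply: measure_semi_bigcup => //.
  - by move=> i; exact: measurable_xsection.
  - exact: trivIset_xsection.
  - by rewrite -xsection_bigcup; exact: measurable_xsection.
rewrite integral_nneseries//; last by move=> n; exact: measurable_section_prob.
by apply: is_cvg_ereal_nneg_natsum_cond => i _ _; exact: joint_ge0.
Qed.

HB.instance Definition _ := isMeasure.Build _ _ _ (joint mQ) joint0 joint_ge0 joint_sigma_additive.

(** Rectangles form a pi-system generating the product sigma-algebra, and [joint] has the same
    values as [m] on them. *)
Lemma joint_unique (m : probability (W * Y)%type R) :
  (forall A B, measurable A -> measurable B -> m (A `*` B) = (\int[mu]_(w in A) Q w B)%E) ->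
  forall C, measurable C -> m C = (\int[mu]_w Q w (xsection C w))%E.
Proof.
move=> mAB C mC.
apply: (@measure_unique _ R _ [set A `*` B | A in measurable & B in measurable]
  (fun=> setT) _ _ _ _ m (joint mQ)) => //.
- exact: measurable_prod_measurableType.
- move=> _ _ [A1 mA1 [B1 mB1 <-]] [A2 mA2 [B2 mB2 <-]].
  exists (A1 `&` A2); first exact: measurableI.
  by exists (B1 `&` B2); [exact: measurableI|rewrite setXI].
- by move=> _; exists setT => //; exists setT => //; rewrite setXTT.
- by rewrite bigcup_const.
- move=> _ [A mA [B mB <-]]; transitivity (\int[mu]_(w in A) Q w B)%E; first exact: mAB.
  rewrite integral_mkcond; apply: eq_integral => w _.
  rewrite patchE; case: ifPn => wA; first by rewrite in_xsectionX.
  by rewrite notin_xsectionX// measure0.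
- by move=> _; apply: (le_lt_trans (probability_le1 m measurableT)); exact: ltry.
Qed.

End Disintegration.

(** * Discretisation and uniform deviations *)

Section FiniteFactor.
Context {R : realType} {d : measure_display} {T : measurableType d} {E : finType}.
Variable enc : T -> E.
Hypothesis menc : forall e, measurable (enc @^-1` [set e]).

Lemma measurable_finite_factor (g : E -> R) : measurable_fun setT (g \o enc).
Proof.
rewrite (_ : g \o enc = fun x => \sum_e g e * \1_(enc @^-1` [set e]) x).
  by apply: measurable_sum => e; apply: measurable_funM.
apply/funext => x /=; rewrite (bigD1 (enc x)) //= indicE mem_set// mulr1.
by rewrite big1 ?addr0// => e /eqP ex; rewrite indicE memNset ?mulr0//= => /esym.
Qed.

Lemma measurable_finite_pred (A : pred E) : measurable [set x | A (enc x)].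
Proof.
rewrite (_ : [set x | _] = \bigcup_(e in [set e | A e]) enc @^-1` [set e]).
  by apply: fin_bigcup_measurable => //; exact: finite_finset.
by apply/seteqP; split => [x Ax|x [e Ae /= xe]] /=; [exists (enc x)|rewrite xe].
Qed.

Lemma integral_finite_factor (m : {finite_measure set T -> \bar R}) (g : E -> R) :
  (forall e, 0 <= g e) ->
  (\int[m]_x (g (enc x))%:E = (\sum_e g e * fine (m (enc @^-1` [set e])))%:E)%E.
Proof.
move=> g0.
transitivity (\int[m]_x (\sum_(e <- enum E) (g e)%:E * (\1_(enc @^-1` [set e]) x)%:E))%E.
  apply: eq_integral => x _; rewrite big_enum/= (bigD1 (enc x)) //= indicE mem_set// mule1.
  by rewrite big1 ?adde0// => e /eqP ex; rewrite indicE memNset ?mule0//= => /esym.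
rewrite ge0_integral_sum//; last 2 first.
- by move=> e; apply: emeasurable_funM => //; exact/measurable_EFinP.
- by move=> e x _; rewrite mule_ge0// lee_fin.
rewrite big_enum/= -sumEFin; apply: eq_bigr => e _.
rewrite ge0_integralZl ?lee_fin//; last exact/measurable_EFinP.
by rewrite integral_indic// setIT EFinM fineK// fin_num_measure.
Qed.

Lemma sum_finite_factor_prob (m : probability T R) :
  \sum_e fine (m (enc @^-1` [set e])) = 1.
Proof.
have h : (\int[m]_x (1 : R)%:E = 1)%E.
  by rewrite integral_cst// mul1e; exact: probability_setT.
have [<-] := etrans (esym (integral_finite_factor m (fun=> 1) (fun=> ler01))) h.
by apply: eq_bigr => e _; rewrite mul1r.
Qed.

End FiniteFactor.

Section FiniteDisintegration.
Context {R : realType} {dW dY : measure_display} {W : measurableType dW}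
  {Y : measurableType dY} {E : finType}.
Variables (mu : {measure set W -> \bar R}) (Q : W -> probability Y R)
  (m : probability (W * Y)%type R) (enc : W * Y -> E).
Hypothesis mQ : forall B, measurable B -> measurable_fun setT (fun w => Q w B : \bar R).
Hypothesis mAB : forall A B, measurable A -> measurable B ->
  m (A `*` B) = (\int[mu]_(w in A) Q w B)%E.
Hypothesis menc : forall e, measurable (enc @^-1` [set e]).

Lemma section_finite_factor (g : E -> R) w : (forall e, 0 <= g e) ->
  (\int[Q w]_y (g (enc (w, y)))%:E =
   \sum_(e <- enum E) (g e)%:E * Q w (xsection (enc @^-1` [set e]) w))%E.
Proof.
move=> g0; rewrite (integral_finite_factor (fun y => enc (w, y)))//; last first.
  move=> e; have := measurable_xsection w (menc e).
  by rewrite xsectionE.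
rewrite big_enum/= -sumEFin; apply: eq_bigr => e _; rewrite EFinM fineK.
  by rewrite xsectionE.
rewrite fin_num_measure//; have := measurable_xsection w (menc e).
by rewrite xsectionE.
Qed.

Lemma measurable_section_factor (g : E -> R) : (forall e, 0 <= g e) ->
  measurable_fun setT (fun w => \int[Q w]_y (g (enc (w, y)))%:E)%E.
Proof.
move=> g0; under eq_fun do rewrite section_finite_factor//.
apply: emeasurable_sum => e; apply: emeasurable_funM => //.
exact: measurable_section_prob.
Qed.

(** An integrand with finitely many values reduces the claim to the measures of its fibres, which
    [joint_unique] disintegrates. *)
Lemma integral_finite_disintegration (g : E -> R) : (forall e, 0 <= g e) ->
  (\int[m]_x (g (enc x))%:E = \int[mu]_w \int[Q w]_y (g (enc (w, y)))%:E)%E.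
Proof.
move=> g0; rewrite integral_finite_factor// -sumEFin -big_enum/=.
under [RHS]eq_integral do rewrite section_finite_factor//.
rewrite ge0_integral_sum//; last 2 first.
- by move=> e; apply: emeasurable_funM => //; exact: measurable_section_prob.
- by move=> e w _; rewrite mule_ge0// lee_fin.
apply: eq_bigr => e _; rewrite EFinM fineK ?fin_num_measure//.
rewrite (joint_unique mu Q mQ)//.
rewrite ge0_integralZl ?lee_fin//; exact: measurable_section_prob.
Qed.

End FiniteDisintegration.

(** * Rounding of values in [-1, 1] *)

Section Code.
Context {R : realType} (K : nat).
Implicit Types x : R.

Definition level (k : nat) : R := -1 + 2 * k%:R / K%:R.

(** Counting the levels strictly below [x] rounds [x] up to the next level. In this form a code is
    determined by [K] comparisons, each a superlevel event; the count is at most [K], so [inord]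
    never takes its default value. *)
Definition code x : 'I_K.+1 := inord (\sum_(k < K) (level k < x)%R).

(** The count is the ceiling of [t]. *)
Lemma sum_lt_nat (m : nat) (t : R) : 0 <= t <= m%:R ->
  t <= (\sum_(k < m) (k%:R < t)%R)%:R < t + 1.
Proof.
elim: m => [|m IH] /andP[t0 tm].
  by rewrite big_ord0; apply/andP; split; rewrite ?ltr_wpDl//; lra.
rewrite big_ord_recr /=; have [mt|tm'] := ltP m%:R t; last first.
  by rewrite addn0; apply: IH; rewrite t0.
rewrite (eq_bigr (fun=> 1%N)); last first.
  by move=> k _; rewrite (le_lt_trans _ mt)// ler_nat ltnW.
rewrite sum1_card card_ord addn1 tm/= -natr1.
by rewrite ltrD2r.
Qed.

Hypothesis K0 : (0 < K)%N.

Lemma code_level x : `|x| <= 1 -> x <= level (code x) <= x + 2 / K%:R.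
Proof.
rewrite ler_norml => /andP[x1 x2].
have K0' : 0 < K%:R :> R by rewrite ltr0n.
pose t := (x + 1) * K%:R / 2.
have lt k : (level k < x) = (k%:R < t).
  rewrite /level /t ltr_pdivlMr// addrC -ltrBrDr opprK ltr_pdivrMr//.
  by rewrite [2 * _]mulrC.
have t01 : 0 <= t <= K%:R.
  apply/andP; split; first by rewrite /t !mulr_ge0//; lra.
  rewrite /t ler_pdivrMr// mulrC ler_pM2l//; lra.
have := sum_lt_nat K t t01.
rewrite /code inordK; last first.
  rewrite ltnS; apply: (@leq_trans (\sum_(k < K) 1)%N).
    by apply: leq_sum => k _; exact: leq_b1.
  by rewrite sum1_card card_ord.
under eq_bigr do rewrite -lt.
set s := (\sum_(k < K) _)%N; clearbody s => /andP[ts st].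
have -> : x = -1 + 2 * t / K%:R by rewrite /t; field; rewrite gt_eqF.
rewrite /level lerD2l ler_pM2r ?invr_gt0// ler_pM2l// ts /=.
rewrite -addrA lerD2l -mulrDl ler_pM2r ?invr_gt0//; lra.
Qed.

Lemma level_norm_le1 (c : 'I_K.+1) : `|level c| <= 1.
Proof.
have K0' : 0 < K%:R :> R by rewrite ltr0n.
have c1 : c%:R / K%:R <= 1 :> R by rewrite ler_pdivrMr// mul1r ler_nat -ltnS.
have c0 : 0 <= c%:R / K%:R :> R by rewrite divr_ge0.
by rewrite /level -mulrA ler_norml; apply/andP; split; lra.
Qed.

Lemma measurable_code {d} {T : measurableType d} (f : T -> R) c :
  measurable_fun setT f -> measurable ((code \o f) @^-1` [set c]).
Proof.
move=> mf.
pose enc (x : T) : {ffun 'I_K -> bool} := [ffun k : 'I_K => level k < f x].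
have menc e : measurable (enc @^-1` [set e]).
  rewrite (_ : _ @^-1` _ = \bigcap_(k in [set: 'I_K]) [set x | (level k < f x) = e k]).
    apply: fin_bigcap_measurable => // k _.
    have mk : measurable [set x | level k < f x].
      have := measurable_fun_ltr (measurable_cst (level k)) mf measurableT (Y := [set true]).
      by rewrite setTI; apply.
    case: (e k); first by apply: (eq_ind _ measurable mk); apply/seteqP; split.
    rewrite (_ : [set x | _] = ~` [set x | level k < f x]); first exact: measurableC.
    by apply/seteqP; split => x /=; [move=> ->|move/negP/negbTE].
  apply/seteqP; split => [x /= <- k _ /=|x /= h]; first by rewrite ffunE.
  by apply/ffunP => k; rewrite ffunE; exact: h.
have := measurable_finite_pred enc menc (fun e => inord (\sum_(k < K) e k)%N == c).
congr measurable.
apply/seteqP; split => x /=; rewrite /code; under eq_bigr do rewrite ffunE.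
  by move/eqP.
by move=> ->.
Qed.

End Code.

(** * Deviation bound for a finite class of functions *)

Section Deviation.
Context {R : realType} {dO dT : measure_display} {Omega : measurableType dO}
  {T : measurableType dT} {J : finType}.
Variables (P : probability Omega R) (n : nat) (X : 'I_n -> Omega -> T)
  (f : J -> T -> R) (K N : nat) (t0 : T).
Hypotheses (mX : forall i, measurable_fun setT (X i)) (indX : mutually_independent P X)
  (mf : forall j, measurable_fun setT (f j)) (K0 : (0 < K)%N).

Let cd j x := code K (f j x).

(** The mean of the tilted value; 1 is added before integration, to make the integrand nonnegative,
    and removed afterwards. *)
Definition tilt_mean (i : 'I_n) (j : J) : R :=
  fine (\int[law P (X i) (mX i)]_x (1 + tilt (level K (code K (f j x))))%:E)%E - 1.

Definition deviation_event (B : R) : set Omega :=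
  [set o | exists j, B < \sum_i level K (code K (f j (X i o))) - \sum_i tilt_mean i j].

Hypothesis cardN : forall z : 'I_n -> T * T,
  (#|[set [ffun i => (cd j (z i).1, cd j (z i).2)] | j : J]%SET| <= N)%N.

(** A point matters only through its codes under all indices, so the laws of the observations become
    laws on the finite type [E], where [ghost_deviation] applies. *)
Let E := {ffun J -> 'I_K.+1}.
Let enc (x : T) : E := [ffun j => cd j x].

Let menc e : measurable (enc @^-1` [set e]).
Proof.
rewrite (_ : _ @^-1` _ = \bigcap_(j in [set: J]) ((code K \o f j) @^-1` [set e j])).
  by apply: fin_bigcap_measurable => // j _; exact: measurable_code.
apply/seteqP; split => [x /= <- j _ /=|x /= h]; first by rewrite ffunE.
by apply/ffunP => j; rewrite ffunE; exact: h.
Qed.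

(* The pattern bound only concerns codes of actual points, so unrealised codes
   are sent to an arbitrary point. *)
Let rep (e : E) : T := if pselect (exists x, enc x = e) is left h then sval (cid h) else t0.

Let repK x : enc (rep (enc x)) = enc x.
Proof.
rewrite /rep; case: pselect => [h|[]]; last by exists x.
by case: cid.
Qed.

Let cd_rep j x : cd j (rep (enc x)) = cd j x.
Proof. by have /ffunP/(_ j) := repK x; rewrite !ffunE. Qed.

Let p i e := fine (law P (X i) (mX i) (enc @^-1` [set e])).

Let p0 i e : 0 <= p i e. Proof. exact: fine_ge0. Qed.

Let tilt_meanE i j : tilt_mean i j = \sum_e p i e * tilt (level K (cd j (rep e))).
Proof.
have h0 e : 0 <= 1 + tilt (level K (cd j (rep e))).
  by apply: tilt_ge0; exact: level_norm_le1.
rewrite /tilt_mean (eq_integral (fun x => (1 + tilt (level K (cd j (rep (enc x)))))%:E)); last first.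
  by move=> x _; rewrite cd_rep.
rewrite (integral_finite_factor enc menc _ (fun e => 1 + tilt (level K (cd j (rep e))))) //=.
have p1 : \sum_e p i e = 1 by exact: sum_finite_factor_prob.
under eq_bigr do rewrite mulrDl mul1r.
rewrite big_split/= p1 [1 + _]addrC addrK; apply: eq_bigr => e _; exact: mulrC.
Qed.

Let path (o : Omega) : {ffun 'I_n -> E} := [ffun i => enc (X i o)].

Let mpath x : measurable (path @^-1` [set x]).
Proof.
rewrite (_ : _ @^-1` _ = \bigcap_(i in [set: 'I_n]) (X i @^-1` (enc @^-1` [set x i]))).
  apply: fin_bigcap_measurable => // i _; rewrite -[X in measurable X]setTI.
  by apply: mX.
apply/seteqP; split => [w /= <- i _ /=|w /= h]; first by rewrite ffunE.
by apply/ffunP => i; rewrite ffunE; exact: h.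
Qed.

Let A (B : R) (x : {ffun 'I_n -> E}) :=
  [exists j, B < \sum_i level K (cd j (rep (x i))) -
     \sum_i \sum_e p i e * (level K (cd j (rep e)) + 8^-1 * level K (cd j (rep e)) ^+ 2)].

Let eventE B : deviation_event B = [set o | A B (path o)].
Proof.
have e (j : J) (o : Omega) : \sum_i level K (code K (f j (X i o))) - \sum_i tilt_mean i j =
   \sum_i level K (cd j (rep (path o i))) -
     \sum_i \sum_e p i e * (level K (cd j (rep e)) + 8^-1 * level K (cd j (rep e)) ^+ 2).
  congr (_ - _); last by apply: eq_bigr => i _; exact: tilt_meanE.
  by apply: eq_bigr => i _; rewrite ffunE cd_rep.
apply/seteqP; split => o /=.
  by move=> [j jB]; apply/existsP; exists j; rewrite -e.
by move=> /existsP[j jB]; exists j; rewrite e.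
Qed.

Lemma measurable_deviation_event B : measurable (deviation_event B).
Proof. by rewrite eventE; exact: (measurable_finite_pred path mpath). Qed.

Lemma deviation_event_le B : (P (deviation_event B) <= (N%:R * expR (- (50^-1 * B)))%:E)%E.
Proof.
have mA := measurable_finite_pred path mpath (A B).
rewrite eventE -[X in P X]setIT -integral_indic//.
rewrite (eq_integral (fun o => ((A B (path o))%:R)%:E)); last first.
  by move=> o _; rewrite indicE; congr ((nat_of_bool _)%:R%:E); apply/idP/idP => [/set_mem//|/mem_set].
rewrite (integral_finite_factor path mpath P (fun x => (A B x)%:R))// lee_fin.
have p1 i : \sum_e p i e = 1 by exact: sum_finite_factor_prob.
have := ghost_deviation R n J E 'I_K.+1 p (fun j e => cd j (rep e)) (fun k => level K k) N
  p0 p1 (level_norm_le1 K K0) _ B.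
have cN (z : {ffun 'I_n -> E * E}) :
    (#|patterns n J E 'I_K.+1 (fun j e => cd j (rep e)) z| <= N)%N.
  exact: (cardN (fun i => (rep (z i).1, rep (z i).2))).
move=> /(_ cN); apply: le_trans; rewrite [leRHS]big_mkcond/=.
apply: ler_sum => x _; rewrite -/(A B x).
have -> : fine (P (path @^-1` [set x])) = \prod_i p i (x i).
  rewrite -[RHS](indX (fun i => enc @^-1` [set x i]))//; congr (fine (P _)).
  apply/seteqP; split => [w /= <- i _ /=|w /= h]; first by rewrite ffunE.
  by apply/ffunP => i; rewrite ffunE; exact: h.
by case: (A B x); rewrite ?mul1r ?mul0r.
Qed.

End Deviation.

Lemma psi_sqrt_mono (R : realType) (r s : R) : 0 <= r -> r <= s ->
  psi (Num.sqrt r) <= psi (Num.sqrt s).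
Proof.
move=> r0 rs; have s0 := le_trans r0 rs.
have : Num.sqrt r <= Num.sqrt s by rewrite ler_sqrt.
have := sqrtr_ge0 r; move: (Num.sqrt r) (Num.sqrt s) => x y x0 xy.
rewrite /psi ler_pdivrMr; last lra.
rewrite mulrAC ler_pdivlMr; last lra.
lra.
Qed.

(** * Number of patterns of the rounded tests *)

Section Patterns.
Context {R : realType} {dY : measure_display} {Y : measurableType dY} {W : Type} {J : finType}.
Variables (nu : {measure set Y -> \bar R}) (S : Y -> R).
Hypotheses (mS : measurable_fun setT S)
  (Sc : ~ (exists c : R, {ae nu, forall y, S y = c})).

Definition test_fun (thb th : W -> R) (x : W * Y) : R :=
  psi (Num.sqrt (qdens nu S (th x.1) x.2 / qdens nu S (thb x.1) x.2)).

Lemma test_fun_norm_le1 thb th x : `|test_fun thb th x| <= 1.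
Proof. by apply: psi_norm_le1; exact: sqrtr_ge0. Qed.

(** A threshold event is indexed by a coordinate, a choice of sample or ghost point, and a level,
    which makes [n * 2 * K] events. Each is an interval condition on the parameter, by
    quasi-concavity of the density and monotonicity of [psi], which doubles the exponent; the codes
    are functions of these events. *)
Lemma card_test_patterns (Thb : set (W -> R)) (V n K : nat) (th : J -> W -> R)
    (thb : W -> R) (z : 'I_n -> (W * Y) * (W * Y)) (a : R) :
  VC_subgraph_dim_le Thb V -> (forall j, Thb (th j)) ->
  (forall j w, \int[nu]_y (expR (th j w * S y))%:E < +oo)%E -> 0 < a <= 1 ->
  #|[set [ffun i => (code K (test_fun thb (th j) (z i).1),
                     code K (test_fun thb (th j) (z i).2))] | j : J]%SET|%:R <=
    a^-1 ^+ V * (1 + a) ^+ (n * 2 * K * 2).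
Proof.
move=> VC hTh Zth a01.
pose U : finType := ('I_n * bool * 'I_K)%type.
pose pt (u : U) := if u.1.2 then (z u.1.1).1 else (z u.1.1).2.
pose Pr (u : U) (t : R) :=
  level K u.2 < psi (Num.sqrt (qdens nu S t (pt u).2 / qdens nu S (thb (pt u).1) (pt u).2)).
have cP (u : U) (j1 j2 j3 : J) : Pr u (th j1 (pt u).1) -> Pr u (th j3 (pt u).1) ->
    th j1 (pt u).1 <= th j2 (pt u).1 <= th j3 (pt u).1 -> Pr u (th j2 (pt u).1).
  move=> h1 h3 h; rewrite /Pr; set q := qdens nu S.
  (* Quasi-concavity, obtained by taking the superlevel set at the value reached by [j2] itself. *)
  have qmin : Num.min (q (th j1 (pt u).1) (pt u).2) (q (th j3 (pt u).1) (pt u).2) <=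
      q (th j2 (pt u).1) (pt u).2.
    rewrite leNgt; apply/negP; rewrite lt_min => /andP[l1 l3].
    have := qdens_superlevel_convex nu S mS Sc _ _ _ _ _
      (Zth j1 (pt u).1) (Zth j2 (pt u).1) (Zth j3 (pt u).1) h l1 l3.
    by rewrite ltxx.
  have mono t : q t (pt u).2 <= q (th j2 (pt u).1) (pt u).2 -> Pr u t -> Pr u (th j2 (pt u).1).
    move=> qt /lt_le_trans; apply; apply: psi_sqrt_mono.
      exact: (divr_ge0 (ltW (qdens_gt0 nu S _ _)) (ltW (qdens_gt0 nu S _ _))).
    by apply: ler_wpM2r qt; rewrite invr_ge0; exact: ltW (qdens_gt0 nu S _ _).
  by move: qmin; rewrite ge_min => /orP[] /mono; apply.
have := card_convex_patterns Thb V J U th (fun u => (pt u).1) Pr a VC hTh cP a01.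
rewrite !card_prod !card_ord card_bool; apply: le_trans.
pose Phi (A : {set U}) : {ffun 'I_n -> 'I_K.+1 * 'I_K.+1} :=
  [ffun i => (inord (\sum_(k < K) ((i, true, k) \in A)), inord (\sum_(k < K) ((i, false, k) \in A)))].
rewrite (_ : [set [ffun i => _] | j : J]%SET =
  [set Phi X | X in [set [set u | `[< Pr u (th j (pt u).1) >]] | j : J]]%SET).
  by rewrite ler_nat leq_imset_card.
rewrite -imset_comp; apply: eq_imset => j /=; apply/ffunP => i; rewrite !ffunE /code.
by congr (_, _); congr inord; apply: eq_bigr => k _; rewrite inE asboolb.
Qed.

End Patterns.

(** With [M] thresholds and [a = V / M], the factor [(1 + a) ^+ M] is at most [expR V]. For
    [r = n / V], the inverse of [a] is [4 * r * K], at most [8 * r ^+ 2], and 8 is bounded by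
    [expR 7]; hence the constant 7 + 1 = 8. *)
Lemma pattern_bound_expR (R : realType) (n V : nat) : (0 < V)%N -> (V < n)%N ->
  let K := (n %/ V).+1 in let a : R := V%:R / (n * 2 * K * 2)%:R in
  0 < a <= 1 /\
  a^-1 ^+ V * (1 + a) ^+ (n * 2 * K * 2) <= expR (V%:R * (8 + 2 * ln (n%:R / V%:R))).
Proof.
move=> V0 Vn K a.
have V0' : 0 < V%:R :> R by rewrite ltr0n.
have n0' : 0 < n%:R :> R by rewrite ltr0n (leq_ltn_trans _ Vn).
set M := (n * 2 * K * 2)%N in a *.
have M0 : (0 < M)%N by rewrite /M !muln_gt0 (leq_ltn_trans _ Vn).
have M0' : 0 < M%:R :> R by rewrite ltr0n.
have VM : (V <= M)%N by rewrite /M; apply: (leq_trans (ltnW Vn)); rewrite -!mulnA leq_pmulr// muln_gt0.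
have a0 : 0 < a by rewrite divr_gt0.
have a1 : a <= 1 by rewrite ler_pdivrMr// mul1r ler_nat.
split; first by rewrite a0 a1.
pose r : R := n%:R / V%:R.
have r0 : 0 < r by rewrite divr_gt0.
have r1 : 1 <= r by rewrite ler_pdivlMr// mul1r ler_nat ltnW.
have Kr : K%:R <= 2 * r.
  have : K%:R <= r + 1.
    rewrite /K -natr1 lerD2r ler_pdivlMr// -natrM ler_nat; exact: leq_trunc_div.
  by move: r1; lra.
have av : a^-1 <= 8 * r ^+ 2.
  rewrite /a invf_div /M !natrM.
  rewrite (_ : _ / _ = 4 * r * K%:R); last by rewrite /r; field; rewrite gt_eqF.
  have := ler_wpM2l (ltW r0) Kr; rewrite expr2; lra.
have -> : V%:R * (8 + 2 * ln r) = (7 + ln (r ^+ 2)) * V%:R + a * M%:R.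
  by rewrite lnXn// mulr2n /a divfK ?gt_eqF//; ring.
rewrite expRD !expRM_natr ler_pM ?exprn_ge0 ?invr_ge0 ?addr_ge0 ?(ltW a0)//.
  rewrite lerXn2r ?nnegrE ?invr_ge0 ?expR_ge0 ?(ltW a0)//; apply: le_trans av _.
  rewrite expRD lnK ?posrE ?exprn_gt0// ler_pM2r ?exprn_gt0//.
  by have := expR_ge1Dx (7 : R); lra.
by rewrite lerXn2r ?nnegrE ?expR_ge0 ?addr_ge0 ?(ltW a0)// expR_ge1Dx.
Qed.

(** The derivative of [tilt] is at most 1 + 1/4 on [-1, 1]. *)
Lemma tilt_lip (R : realType) (a b : R) : `|a| <= 1 -> `|b| <= 1 -> a <= b ->
  tilt b <= tilt a + 5 / 4 * (b - a).
Proof.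
rewrite !ler_norml /tilt => /andP[a1 a2] /andP[b1 b2] ab.
rewrite -subr_ge0 [X in 0 <= X](_ : _ = (b - a) * (8^-1 * (2 - (a + b)))); last by field.
by rewrite !mulr_ge0//; lra.
Qed.

(** * Means of the rounded test and the risk *)

Section Risk.
Context {R : realType} {dO dW dY : measure_display} {Omega : measurableType dO}
  {W : measurableType dW} {Y : measurableType dY}.
Variables (P : probability Omega R) (X : Omega -> W * Y) (Q : W -> probability Y R)
  (nu : {measure set Y -> \bar R}) (S : Y -> R) (thb th : W -> R) (K : nat).
Hypotheses (mX : measurable_fun setT X)
  (mQ : forall B, measurable B -> measurable_fun setT (fun w => Q w B : \bar R))
  (PQ : forall (A : set W) (B : set Y), measurable A -> measurable B ->
     P (X @^-1` (A `*` B)) = (\int[pushforward P (fun o => (X o).1)]_(w in A) Q w B)%E)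
  (sf : sigma_finite setT nu) (mS : measurable_fun setT S)
  (Sc : ~ (exists c : R, {ae nu, forall y, S y = c}))
  (Zthb : forall w, (\int[nu]_y (expR (thb w * S y))%:E < +oo)%E)
  (Zth : forall w, (\int[nu]_y (expR (th w * S y))%:E < +oo)%E)
  (mthb : measurable_fun setT thb) (mth : measurable_fun setT th) (K0 : (0 < K)%N).

Let mX1 : measurable_fun setT (fun o => (X o).1).
Proof. exact: measurableT_comp. Qed.

Let mu : probability W R := law P (fun o => (X o).1) mX1.

Let H (t : W -> R) := (\int[pushforward P (fun o => (X o).1)]_w hellinger2 (Q w) (Qexp nu S (t w)))%E.

Lemma hell_ge0 t w : (\int[nu]_y (expR (t * S y))%:E < +oo)%E -> (0 <= hellinger2 (Q w) (Qexp nu S t))%E.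
Proof. by move=> Zt; rewrite (qprobE _ _ mS Sc t Zt); exact: hellinger2_ge0. Qed.

Lemma hell_le1 t w : (\int[nu]_y (expR (t * S y))%:E < +oo)%E -> (hellinger2 (Q w) (Qexp nu S t) <= 1)%E.
Proof. by move=> Zt; rewrite (qprobE _ _ mS Sc t Zt); exact: hellinger2_le1. Qed.

Lemma risk_ge0_le1 t : (forall w, \int[nu]_y (expR (t w * S y))%:E < +oo)%E ->
  (0 <= H t <= 1)%E.
Proof.
move=> Zt; rewrite /H -[pushforward _ _]/(mu : set W -> \bar R).
have h0 w := hell_ge0 (t w) w (Zt w); apply/andP; split.
  by apply: (integral_ge0 mu) => w _; exact: h0.
apply: (@le_trans _ _ (\int[mu]_w 1)%E); last first.
  by rewrite integral_cst// mul1e; exact: probability_le1.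
by apply: (lower_integral_mono mu) => w; rewrite h0 hell_le1.
Qed.

Lemma measurable_test_fun : measurable_fun setT (test_fun nu S thb th).
Proof.
have mq t : measurable_fun setT t -> measurable_fun setT (fun x : W * Y => S x.2 * t x.1 - logpart nu S (t x.1)).
  move=> mt; apply: measurable_funB.
    by apply: measurable_funM; exact: measurableT_comp.
  apply: (measurableT_comp (f := logpart nu S)).
    by apply: measurableT_comp => //; apply: measurableT_comp => //; exact: measurable_laplace.
  exact: measurableT_comp.
apply: measurable_funT_psi => [|x]; last exact: sqrtr_ge0.
apply: measurable_funT_sqrt.
rewrite (_ : (fun x => _) = (fun x : W * Y => expR ((S x.2 * th x.1 - logpart nu S (th x.1)) -
  (S x.2 * thb x.1 - logpart nu S (thb x.1))))).
  by apply: measurableT_comp => //; apply: measurable_funB; exact: mq.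
by apply/funext => x; rewrite /qdens -expRN -expRD.
Qed.

(** For each [w], [qexp_test] holds for the conditional law, and rounding adds at most 5/4 times the
    mesh [2 / K]. Integrating over [w] uses measurability only of [G], which comes from the rounded
    test; the Hellinger terms are handled as lower integrals. *)
Lemma mean_le_risk :
  fine (\int[law P X mX]_x (1 + tilt (level K (code K (test_fun nu S thb th x))))%:E)%E - 1 <=
  5 / 4 * (2 / K%:R) + 15 / 4 * fine (H thb) - 8^-1 * fine (H th).
Proof.
have K0' : 0 < K%:R :> R by rewrite ltr0n.
set f := test_fun nu S thb th.
have mf : measurable_fun setT f := measurable_test_fun.
have menc c : measurable ((code K \o f) @^-1` [set c]) by exact: measurable_code.
pose g (c : 'I_K.+1) : R := 1 + tilt (level K c).
have g0 c : 0 <= g c by apply: tilt_ge0; exact: level_norm_le1.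
pose G w := (\int[Q w]_y (g ((code K \o f) (w, y)))%:E)%E.
have GE : (\int[law P X mX]_x (g ((code K \o f) x))%:E = \int[mu]_w G w)%E.
  have mAB (A : set W) (B : set Y) : measurable A -> measurable B ->
      (law P X mX (A `*` B) = \int[mu]_(w in A) Q w B)%E.
    by move=> mA mB; rewrite lawE PQ.
  exact: (integral_finite_disintegration mu Q (law P X mX) (code K \o f) mQ mAB menc).
have Gfin : (\int[mu]_w G w)%E \is a fin_num.
  by rewrite -GE (integral_finite_factor (code K \o f) menc (law P X mX) g g0).
have mG : measurable_fun setT G.
  exact: (measurable_section_factor Q (code K \o f) mQ menc g g0).
have G0 w : (0 <= G w)%E by apply: integral_ge0 => y _; rewrite lee_fin.
have d0 : 0 <= 5 / 4 * (2 / K%:R) :> R by rewrite mulr_ge0// divr_ge0// ltW.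
have arith (u v : \bar R) (d c1 c2 : R) (h1 h2 : \bar R) : (u <= v + d%:E)%E ->
    (v + c1%:E * h1 <= 1 + c2%:E * h2)%E -> (u + c1%:E * h1 <= (1 + d)%:E + c2%:E * h2)%E.
  move=> uv vh; apply: (le_trans (leeD2r _ uv)); rewrite [leLHS]addeAC EFinD [leRHS]addeAC.
  exact: leeD2r.
have to_real (u u' a b : \bar R) (d c1 c2 : R) : u' = u -> u \is a fin_num ->
    (0 <= a <= 1)%E -> (0 <= b <= 1)%E ->
    (u + c1%:E * a <= (1 + d)%:E + c2%:E * b)%E ->
    fine u' - 1 <= d + c2 * fine b - c1 * fine a.
  have fin01 (c : \bar R) : (0 <= c <= 1)%E -> c \is a fin_num.
    by move=> /andP[h0 h1]; rewrite ge0_fin_numE//; exact: le_lt_trans h1 (ltry _).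
  move=> -> uf /fin01 af /fin01 bf.
  rewrite -(fineK uf) -(fineK af) -(fineK bf) -!EFinM -!EFinD lee_fin /=; lra.
have main w : (G w + (8^-1)%:E * hellinger2 (Q w) (Qexp nu S (th w)) <=
    (1 + 5 / 4 * (2 / K%:R))%:E + (15 / 4)%:E * hellinger2 (Q w) (Qexp nu S (thb w)))%E.
  have := qexp_test nu S mS Sc (Q w) _ _ (Zthb w) (Zth w).
  set A := (\int[_]__ _)%E => test.
  have GA : (G w <= A + (5 / 4 * (2 / K%:R))%:E)%E.
    have mfw : measurable_fun setT (fun y => f (w, y)).
      by apply: (measurableT_comp mf); exact: measurable_fun_pair.
    have mt : measurable_fun setT (fun y => (1 + tilt (f (w, y)))%:E).
      apply/measurable_EFinP; apply: measurable_funD => //; apply: measurable_funD => //.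
      by apply: measurable_funM => //; exact: measurable_funX.
    have -> : (A + (5 / 4 * (2 / K%:R))%:E =
       \int[Q w]_y ((1 + tilt (f (w, y)))%:E + (5 / 4 * (2 / K%:R))%:E))%E.
      rewrite ge0_integralD//; last by move=> y _; rewrite lee_fin tilt_ge0// test_fun_norm_le1.
      rewrite integral_cst// (_ : (5 / 4 * (2 / K%:R))%:E * _ = (5 / 4 * (2 / K%:R))%:E)%E//.
      by rewrite -[RHS]mule1; congr (_ * _)%E; exact: probability_setT.
    apply: ge0_le_integral => //.
    - by move=> y _; rewrite lee_fin.
    - rewrite (_ : (fun y => _) = EFin \o (g \o (fun y => (code K \o f) (w, y))))//.
      apply/measurable_EFinP; apply: measurable_finite_factor => e.
      by apply: (measurable_code K (fun y => f (w, y))).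
    - exact: emeasurable_funD.
    move=> y _; rewrite -EFinD lee_fin /g -addrA lerD2l /=.
    have f1 : `|f (w, y)| <= 1 := test_fun_norm_le1 nu S thb th (w, y).
    have /andP[l1 l2] := code_level K K0 _ f1.
    apply: le_trans (tilt_lip _ _ _ f1 (level_norm_le1 K K0 _) l1) _.
    by rewrite lerD2l ler_pM2l// lerBlDl.
  exact: (arith _ _ _ _ _ _ _ GA test).
have aff := lower_integral_affine mu 8^-1 (15 / 4) (1 + 5 / 4 * (2 / K%:R)) G _ _
  (probability_setT mu) ltac:(lra) ltac:(lra) ltac:(lra) mG G0 Gfin
  (fun w => hell_ge0 (th w) w (Zth w)) (fun w => hell_ge0 (thb w) w (Zthb w)) main.
exact: (to_real _ _ _ _ _ _ _ GE Gfin (risk_ge0_le1 _ Zth) (risk_ge0_le1 _ Zthb) aff).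
Qed.

End Risk.

(** * The estimator *)

Lemma psi_sqrt_swap (R : realType) (a b : R) : 0 < a -> 0 < b ->
  psi (Num.sqrt (a / b)) = - psi (Num.sqrt (b / a)).
Proof.
move=> a0 b0; rewrite -psi_inv; last by rewrite sqrtr_gt0 divr_gt0.
by rewrite -sqrtrV ?invf_div// divr_ge0// ltW.
Qed.

Section RhoCriterion.
Context {R : realType} {dY : measure_display} {Y : measurableType dY} {W : Type}.
Variables (nu : set Y -> \bar R) (S : Y -> R) (n : nat) (x : 'I_n -> W * Y).

Lemma Tstat_norm_le th th' : `|Tstat nu S x th th'| <= n%:R.
Proof.
apply: le_trans (ler_norm_sum _ _ _) _.
rewrite -[in leRHS](card_ord n) -sumr_const; apply: ler_sum => i _.
by apply: psi_norm_le1; exact: sqrtr_ge0.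
Qed.

Lemma Tstat_anti th th' : Tstat nu S x th' th = - Tstat nu S x th th'.
Proof.
rewrite /Tstat -sumrN; apply: eq_bigr => i _.
exact: psi_sqrt_swap (expR_gt0 _) (expR_gt0 _).
Qed.

(** The statistic at the estimate is at most its own [upsilon], hence at most that of [th] plus
    [kappa / 25], and the latter [upsilon] is bounded by [U]. *)
Lemma rho_estimate_le (Th : set (W -> R)) th thh (U : R) :
  Th th -> is_rho_estimate nu S Th x thh ->
  (forall th', Th th' -> Tstat nu S x th th' <= U) ->
  Tstat nu S x thh th <= U + kappa / 25.
Proof.
move=> Tth [Tthh hmin] hU.
(* Real suprema and infima are meaningful only for bounded sets; boundedness follows from
   [|psi| <= 1]. *)
have ub t : has_ubound [set Tstat nu S x t th' | th' in Th].
  by exists n%:R => _ [th' _ <-]; exact: le_trans (ler_norm _) (Tstat_norm_le _ _).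
have T_le t th' : Th th' -> Tstat nu S x t th' <= upsilon nu S Th x t.
  by move=> Tth'; apply: ub_le_sup => //; exists th'.
apply: le_trans (T_le _ _ Tth) _; apply: (le_trans hmin); rewrite lerD2r.
apply: (@le_trans _ _ (upsilon nu S Th x th)).
  apply: ge_inf; last by exists th.
  exists (- n%:R) => _ [th' Tth' <-]; apply: le_trans (T_le _ _ Tth).
  by have := Tstat_norm_le th' th; rewrite ler_norml => /andP[].
apply: ge_sup; first by exists (Tstat nu S x th th), th.
by move=> _ [th' Tth' <-]; exact: hU.
Qed.

End RhoCriterion.

Lemma kappa_le (R : realType) : kappa <= 494 :> R.
Proof.
rewrite /kappa; have : Num.sqrt 2 <= 3 / 2 :> R.
  by rewrite -[leRHS]ger0_norm// -sqrtr_sqr ler_sqrt//; lra.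
lra.
Qed.

Lemma countable_enum (T : Type) (A : set T) (a : T) : A a -> countable A ->
  exists2 e : nat -> T, (forall k, A (e k)) & forall x, A x -> exists k, e k = x.
Proof.
move=> Aa /countable_injP[f finj].
have /choice[e eP] : forall k, exists x, A x /\ ((exists2 y, A y & f y = k) -> f x = k).
  move=> k; have [[y Ay fy]|h] := pselect (exists2 y, A y & f y = k); first by exists y.
  by exists a.
exists e => [k|x Ax]; first by have [] := eP k.
exists (f x); have [Ae fe] := eP (f x).
by apply: finj; rewrite ?inE//; apply: fe; exists x.
Qed.

Lemma measure_increasing_union_le (R : realType) d (T : measurableType d)
    (P : probability T R) (F : nat -> set T) (c : \bar R) :
  (forall k, measurable (F k)) -> (forall k, F k `<=` F k.+1) ->
  (forall k, (P (F k) <= c)%E) -> (P (\bigcup_k F k) <= c)%E.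
Proof.
move=> mF ndF Fc.
have nd : nondecreasing_seq F by apply/nondecreasing_seqP => k; apply/subsetPset; exact: ndF.
have cv := nondecreasing_cvg_mu (mu := P) mF (bigcup_measurable (fun k _ => mF k)) nd.
rewrite -(cvg_lim _ cv)//; apply: lime_le; first by apply/cvg_ex; eexists; exact: cv.
by apply: nearW => k; exact: Fc.
Qed.

Lemma real_bound_truncn (R : realType) (b : R) : 0 <= b ->
  exists N : nat, N%:R <= b /\ forall k : nat, k%:R <= b -> (k <= N)%N.
Proof.
move=> b0; have /andP[Nb bN] := truncn_itv b0; exists (Num.truncn b); split => // k kb.
by rewrite -ltnS -(ltr_nat R); exact: le_lt_trans kb bN.
Qed.

Lemma deviation_arith (R : realFieldType) (s m u t v rb r : R) : s - m <= u ->
  m <= t + 15 / 4 * rb - 8^-1 * r -> t <= 5 / 2 * v ->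
  s <= u + 5 / 2 * v + 15 / 4 * rb - 8^-1 * r.
Proof. lra. Qed.

(** * Deviation uniform over a countable model *)

Section UniformDeviation.
Context {R : realType} {dO dW dY : measure_display} {Omega : measurableType dO}
  {W : measurableType dW} {Y : measurableType dY}.
Variables (P : probability Omega R) (n V : nat) (X : 'I_n -> Omega -> W * Y)
  (Qstar : 'I_n -> W -> probability Y R)
  (nu : {measure set Y -> \bar R}) (S : Y -> R) (Thb Th : set (W -> R)) (thb : W -> R).
Hypotheses (mX : forall i, measurable_fun setT (X i)) (indX : mutually_independent P X)
  (mQ : forall i B, measurable B -> measurable_fun setT (fun w => Qstar i w B : \bar R))
  (PQ : forall i (A : set W) (B : set Y), measurable A -> measurable B ->
     P (X i @^-1` (A `*` B)) =
     (\int[pushforward P (fun o => (X i o).1)]_(w in A) Qstar i w B)%E)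
  (sf : sigma_finite setT nu) (mS : measurable_fun setT S)
  (Sc : ~ (exists c : R, {ae nu, forall y, S y = c}))
  (V0 : (1 <= V)%N) (Vn : (V < n)%N) (VC : VC_subgraph_dim_le Thb V)
  (ThThb : Th `<=` Thb) (cTh : countable Th)
  (mTh : forall th, Th th -> measurable_fun setT th)
  (ZTh : forall th, Th th -> forall w, (\int[nu]_y (expR (th w * S y))%:E < +oo)%E)
  (Tthb : Th thb).

Let K := (n %/ V).+1.

Let risk (th : W -> R) : R :=
  \sum_(i < n) fine (\int[pushforward P (fun o => (X i o).1)]_w
    hellinger2 (Qstar i w) (Qexp nu S (th w)))%E.

(** The finite-class bound is applied to the first elements of an enumeration of [Th]. The number of
    patterns does not depend on how many elements are kept, so the increasing union of bad events
    keeps the same probability bound. *)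
Lemma uniform_deviation (xi : R) : exists bad : set Omega,
  [/\ measurable bad, (P bad <= (expR (- xi))%:E)%E &
   forall o, ~ bad o -> forall th, Th th ->
     Tstat nu S (fun i => X i o) thb th <=
     50 * (V%:R * (8 + 2 * ln (n%:R / V%:R)) + xi) + 5 / 2 * V%:R
     + 15 / 4 * risk thb - 8^-1 * risk th].
Proof.
have K0 : (0 < K)%N by [].
have K0' : 0 < K%:R :> R by rewrite ltr0n.
have [a01 bnd] := pattern_bound_expR R n V V0 Vn.
set b := _ ^+ V * _ in bnd; set a := _ / _ in a01 b bnd.
have b0 : 0 <= b.
  have /andP[a0 _] := a01.
  by rewrite /b mulr_ge0 ?exprn_ge0// ?invr_ge0 ?addr_ge0 ?(ltW a0).
(* The pattern bound [b] is real while the deviation lemma counts with a natural number; the integer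
   part of [b] serves both. *)
have [N [Nb bN]] := real_bound_truncn R b b0.
set L := V%:R * (8 + 2 * ln (n%:R / V%:R)) in bnd *.
(* The number of patterns is at most [expR L], so this level leaves exactly [expR (- xi)] after the
   factor 1/50. *)
pose B := 50 * (L + xi).
have hNB : N%:R * expR (- (50^-1 * B)) <= expR (- xi).
  have -> : - (50^-1 * B) = - L - xi by rewrite /B; field.
  apply: (@le_trans _ _ (expR L * expR (- L - xi))).
    by apply: ler_wpM2r; [exact: expR_ge0|exact: le_trans Nb bnd].
  rewrite -expRD; have -> : L + (- L - xi) = - xi by ring.
  exact: lexx.
have /set0P[w0 _] : [set: Omega] != set0.
  apply/eqP => O0; have := probability_setT P; rewrite O0 measure0 => /eqP.
  by rewrite eqe eq_sym oner_eq0.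
have t0 : W * Y := X (Ordinal (leq_ltn_trans (leq0n V) Vn)) w0.
have [e eTh Te] := countable_enum _ Th thb Tthb cTh.
pose f m (j : 'I_m.+1) := test_fun nu S thb (e j).
have mf m j : measurable_fun setT (f m j).
  by apply: measurable_test_fun => //; apply: mTh.
pose bad m := deviation_event P n X (f m) K mX B.
have cardN m (z : 'I_n -> (W * Y) * (W * Y)) :
    (#|[set [ffun i => (code K (f m j (z i).1), code K (f m j (z i).2))] | j : 'I_m.+1]%SET| <= N)%N.
  apply: bN; apply: (card_test_patterns nu S mS Sc Thb V n K (fun j : 'I_m.+1 => e j) thb z a VC _ _ a01).
    by move=> j; exact: ThThb.
  by move=> j w; exact: ZTh.
exists (\bigcup_m bad m); split.
- apply: bigcup_measurable => m _.
  exact: (measurable_deviation_event P n X (f m) K t0 mX (mf m)).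
- apply: measure_increasing_union_le => [m|m o|m].
  + exact: (measurable_deviation_event P n X (f m) K t0 mX (mf m)).
  + by move=> [j jB]; exists (widen_ord (leqnSn _) j).
  apply: le_trans (deviation_event_le P n X (f m) K N t0 mX indX (mf m) K0 (cardN m) B) _.
  by rewrite lee_fin.
move=> o nbad th Tth; have [k ek] := Te th Tth.
have {nbad} : ~ bad k o by apply: contra_not nbad => h; exists k.
(* In the class of the first [k + 1] elements, [th] is the last one. *)
move=> /forallNP/(_ ord_max)/negP; rewrite -leNgt.
rewrite /tilt_mean /f /= ek => dev.
have code_ge : Tstat nu S (fun i => X i o) thb th <=
    \sum_i level K (code K (test_fun nu S thb th (X i o))).
  apply: ler_sum => i _.
  by have /andP[] := code_level K K0 _ (test_fun_norm_le1 nu S thb th (X i o)).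
apply: (le_trans code_ge).
have means : \sum_(i < n) (fine (\int[law P (X i) (mX i)]_x
       (1 + tilt (level K (code K (test_fun nu S thb th x))))%:E)%E - 1) <=
     \sum_(i < n) (5 / 4 * (2 / K%:R)) + 15 / 4 * risk thb - 8^-1 * risk th.
  rewrite /risk !mulr_sumr -big_split -sumrB; apply: ler_sum => i _.
  exact: (mean_le_risk P (X i) (Qstar i) nu S thb th K (mX i) (mQ i) (PQ i) sf mS Sc
    (ZTh thb Tthb) (ZTh th Tth) (mTh thb Tthb) (mTh th Tth) K0).
(* Since [K] is the integer part of [n / V] plus one, [n / K] is at most [V], and rounding costs no
   more than the pattern count. *)
have nK : \sum_(i < n) (5 / 4 * (2 / K%:R)) <= 5 / 2 * V%:R :> R.
  rewrite sumr_const card_ord -[leLHS]mulr_natr.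
  have nVK : n%:R <= V%:R * K%:R :> R.
    by rewrite -natrM ler_nat mulnC ltnW// ltn_ceil.
  rewrite (_ : 5 / 4 * (2 / K%:R) * n%:R = 5 / 2 * (n%:R / K%:R)); last by field; rewrite gt_eqF.
  by rewrite ler_pM2l// ler_pdivrMr.
exact: (deviation_arith _ _ _ _ _ _ _ _ dev means nK).
Qed.

End UniformDeviation.

(** * Numerical constants and conclusion *)

Lemma budget_ge (R : realFieldType) (v Lp : R) : 1 <= v -> 0 <= v * Lp ->
  11 * 1000 * (911 / 100 * v + v * Lp) <= 11 * 10 ^+ 5 * v * (911 / 100 + Lp).
Proof.
move=> v1 vLp; rewrite (_ : _ * v * _ = 11 * 10 ^+ 5 * (911 / 100 * v + v * Lp)); last first.
  by move: (10 ^+ 5) => k; ring.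
apply: ler_wpM2r; first lra.
have -> : 10 ^+ 5 = 1000 * 100 :> R by rewrite -!natrX -natrM; congr _%:R.
lra.
Qed.

(** Antisymmetry cancels the statistic between the two bounds and leaves [r <= 16 * u + 40 * v + 60
    * rb + 8 * kap / 25]. A hundredth of the allowed dimension term, isolated by [budget_ge],
    absorbs the part in [v] and [v * L], and the products are treated as atoms. *)
Lemma final_arith (R : realFieldType) (u rb r s t inf v L Lp xi kap : R) :
  t <= u + 5 / 2 * v + 15 / 4 * rb - 8^-1 * r -> s <= u + 5 / 2 * v + 15 / 4 * rb + kap / 25 ->
  s = - t -> u = 50 * (v * (8 + 2 * L) + xi) -> rb <= inf + 1 -> kap <= 494 ->
  v * L <= v * Lp -> 0 <= v * Lp -> 1 <= v -> 0 <= inf -> 0 < xi ->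
  r <= 150 * inf + (11 * 10 ^+ 5 * v * (911 / 100 + Lp) + 5014 * (3 / 2 + xi)).
Proof.
move=> h1 h2 st uE rbi kl vL vLp v1 i0 xi0.
have := budget_ge _ _ _ v1 vLp.
set budget := 11 * _ * _ * _ => hb.
have {}uE : u = 400 * v + 100 * (v * L) + 50 * xi by rewrite uE; ring.
lra.
Qed.

Lemma trivial_arith (R : realFieldType) (v Lp xi n : R) : 0 <= Lp -> n <= v -> 1 <= v ->
  0 < xi -> n <= 11 * 10 ^+ 5 * v * (911 / 100 + Lp) + 5014 * (3 / 2 + xi).
Proof.
move=> L0 nv v1 xi0; have vL : 0 <= v * Lp by rewrite mulr_ge0//; lra.
have := budget_ge _ _ _ v1 vL; set budget := 11 * _ * _ * _; lra.
Qed.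

Theorem theorem1
  (R : realType)
  (dO : measure_display) (Omega : measurableType dO) (P : probability Omega R)
  (dW : measure_display) (W : measurableType dW)
  (dY : measure_display) (Y : measurableType dY)
  (n : nat) (X : 'I_n -> Omega -> W * Y)
  (Qstar : 'I_n -> W -> probability Y R)
  (nu : {measure set Y -> \bar R}) (S : Y -> R) (I : set R)
  (Thbar Th : set (W -> R)) (V : nat)
  (thhat : Omega -> W -> R) :
  (* observations: independent random variables X_i = (W_i, Y_i) *)
  (forall i, measurable_fun [set: Omega] (X i)) ->
  mutually_independent P X ->
  (* Q_i^* is a measurable map from W to probabilities on Y ... *)
  (forall i B, measurable B -> measurable_fun [set: W] (fun w => Qstar i w B : \bar R)) ->
  (* ... and is the conditional distribution of Y_i given W_i *)
  (forall i (A : set W) (B : set Y), measurable A -> measurable B ->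
     P (X i @^-1` (A `*` B)) =
     (\int[pushforward P (fun o => (X i o).1)]_(w in A) Qstar i w B)%E) ->
  (* exponential family *)
  sigma_finite [set: Y] nu ->
  measurable_fun [set: Y] S ->
  ~ (exists c : R, {ae nu, forall y, S y = c}) ->
  is_interval I -> interior I !=set0 ->
  (forall t, I t -> (\int[nu]_y (expR (t * S y))%:E < +oo)%E) ->
  (* model *)
  (forall f, Thbar f -> forall w, I (f w)) ->
  (1 <= V)%N -> VC_subgraph_dim_le Thbar V ->
  Th `<=` Thbar -> countable Th ->
  (forall th, Th th -> measurable_fun [set: W] th) ->
  (* rho-estimator *)
  (forall th, Th th -> measurable [set o | thhat o = th]) ->
  (forall o, is_rho_estimate nu S Th (fun i => X i o) (thhat o)) ->
  forall xi : R, 0 < xi ->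
  (P [set o |
      (loss (fun i => pushforward P (fun o => (X i o).1))
            (fun i w => Qstar i w) nu S (thhat o)
       <= 150%:E * ereal_inf [set loss (fun i => pushforward P (fun o => (X i o).1))
                                   (fun i w => Qstar i w) nu S th | th in Th]
          + (11 * 10 ^+ 5 * V%:R * (911 / 100 + logplus (n%:R / V%:R))
             + 5014 * (3 / 2 + xi))%:E)%E]
   >= (1 - expR (- xi))%:E)%E.
Proof.
move=> mX indX mQ PQ sf mS Sc _ _ ZI ThbI V0 VC ThThb cTh mTh mthh hrho xi xi0.
have ZTh th : Th th -> forall w, (\int[nu]_y (expR (th w * S y))%:E < +oo)%E.
  by move=> Tth w; apply: ZI; apply: ThbI; exact: ThThb.
pose risk (th : W -> R) : R :=
  \sum_(i < n) fine (\int[pushforward P (fun o => (X i o).1)]_w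
    hellinger2 (Qstar i w) (Qexp nu S (th w)))%E.
pose lossX := loss (fun i => pushforward P (fun o => (X i o).1)) (fun i w => Qstar i w) nu S.
have risk1 th i (Tth : Th th) := risk_ge0_le1 P (X i) (Qstar i) nu S (mX i) mS Sc th (ZTh th Tth).
have lossE th : Th th -> lossX th = (risk th)%:E.
  move=> Tth; rewrite /lossX /loss /risk -sumEFin; apply: eq_bigr => i _.
  have /andP[h0 h1] := risk1 th i Tth.
  by rewrite fineK// ge0_fin_numE//; exact: le_lt_trans h1 (ltry _).
have risk_ge0 th : Th th -> 0 <= risk th.
  move=> Tth; apply: sumr_ge0 => i _; apply: fine_ge0.
  by have /andP[] := risk1 th i Tth.
have risk_le th : Th th -> risk th <= n%:R.
  move=> Tth; rewrite -[in leRHS](card_ord n) -sumr_const; apply: ler_sum => i _.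
  have /andP[h0 h1] := risk1 th i Tth.
  by rewrite -lee_fin fineK// ge0_fin_numE//; exact: le_lt_trans h1 (ltry _).
have /set0P[w0 _] : [set: Omega] != set0.
  apply/eqP => O0; have := probability_setT P; rewrite O0 measure0 => /eqP.
  by rewrite eqe eq_sym oner_eq0.
have [Tthh _] := hrho w0.
set inf := ereal_inf _.
have inf_le th : Th th -> (inf <= (risk th)%:E)%E.
  by move=> Tth; rewrite -lossE//; apply: ereal_inf_lbound; exists th.
have inf_ge0 : (0 <= inf)%E.
  by apply: le_ereal_inf_tmp => _ [th Tth <-]; rewrite -/(lossX th) lossE// lee_fin risk_ge0.
have inf_fin : inf \is a fin_num.
  by rewrite ge0_fin_numE//; exact: le_lt_trans (inf_le _ Tthh) (ltry _).
have Vge1 : 1 <= V%:R :> R by rewrite ler1n.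
have Lp0 : 0 <= logplus (n%:R / V%:R) :> R by rewrite /logplus le_max lexx.
set C : R := _ + 5014 * _.
set good := [set o | _].
have goodE o : good o = (risk (thhat o) <= 150 * fine inf + C) :> Prop.
  have [To _] := hrho o.
  by rewrite /good /= -/(lossX _) lossE// -(fineK inf_fin) -EFinM -EFinD lee_fin.
(* The good event depends on the outcome only through the estimator, which takes countably many
   values with measurable fibres. *)
have mgood : measurable good.
  have [e eTh Te] := countable_enum _ Th _ Tthh cTh.
  rewrite (_ : good = \bigcup_k [set o | thhat o = e k /\ risk (e k) <= 150 * fine inf + C]).
    apply: bigcup_measurable => k _.
    have [le|nle] := pselect (risk (e k) <= 150 * fine inf + C).
      rewrite (_ : [set o | _] = [set o | thhat o = e k]); first exact: mthh.
      by apply/seteqP; split => o /= => [[]|].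
    rewrite (_ : [set o | _] = set0)//.
    by apply/seteqP; split => o //= [_ /nle].
  apply/seteqP; split => o.
    rewrite goodE => go; have [To _] := hrho o; have [k ek] := Te _ To.
    by exists k; [exact: Logic.I|split; [exact: esym ek|rewrite ek; exact: go]].
  by move=> [k _ [ek le]]; rewrite goodE ek; exact: le.
have [bad [mbad Pbad badP]] : exists bad : set Omega,
    [/\ measurable bad, (P bad <= (expR (- xi))%:E)%E & ~` bad `<=` good].
  (* When [n <= V] the risk, being at most [n], is already below the dimension term, and the bad
     event is empty. *)
  have [nV|Vn] := leqP n V.
    exists set0; split; rewrite ?measure0 ?lee_fin ?expR_ge0// => o _.
    rewrite goodE; have [To _] := hrho o.
    apply: (le_trans (risk_le _ To)); apply: (@le_trans _ _ C).
      by apply: trivial_arith => //; rewrite ler_nat.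
    by rewrite lerDr mulr_ge0// fine_ge0.
  (* The infimum need not be attained; a minimiser up to 1 costs an additive 60, absorbed by the
     constants. *)
  have [_ [thb Tthb <-] thb_inf] := lb_ereal_inf_adherent ltr01 inf_fin.
  have {}thb_inf : risk thb <= fine inf + 1.
    move: thb_inf; rewrite -/(lossX thb) lossE// -/inf -(fineK inf_fin) -EFinD lte_fin.
    exact: ltW.
  have [bad [mbad Pbad dev]] := uniform_deviation P n V X Qstar nu S Thbar Th thb
    mX indX mQ PQ sf mS Sc V0 Vn VC ThThb cTh mTh ZTh Tthb xi.
  exists bad; split => // o nbad; rewrite goodE.
  have [To _] := hrho o.
  set u := 50 * _ in dev.
  have dev' th : Th th -> Tstat nu S (fun i => X i o) thb th <= u + 5 / 2 * V%:R + 15 / 4 * risk thb.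
    move=> Tth; apply: le_trans (dev o nbad th Tth) _.
    by rewrite gerBl mulr_ge0 ?invr_ge0// risk_ge0.
  have crit := rho_estimate_le nu S n (fun i => X i o) Th thb (thhat o) _ Tthb (hrho o) dev'.
  have Lle : V%:R * ln (n%:R / V%:R) <= V%:R * logplus (n%:R / V%:R) :> R.
    by apply: ler_wpM2l => //; rewrite /logplus le_max lexx orbT.
  have vLp : 0 <= V%:R * logplus (n%:R / V%:R) :> R by rewrite mulr_ge0.
  exact: (final_arith _ u _ _ _ _ _ _ _ _ xi kappa (dev o nbad _ To) crit
    (Tstat_anti _ _ _ _ _ _) erefl thb_inf (kappa_le R) Lle vLp Vge1 (fine_ge0 inf_ge0) xi0).
apply: (@le_trans _ _ (P (~` bad))); last first.
  by apply: le_measure => //; rewrite inE//; exact: measurableC.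
by rewrite probability_setC// EFinB leeB.
Qed.
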